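(* Let $s\ge 3$ and $t\ge 1$ be fixed integers and let $m\to\infty$ (all $o(1)$ terms are as $m\to\infty$ with $s,t$ fixed). (a) If $n=sm-1$, then for any $t\ge 2$, $$2^n-\mathrm{vex}(n,K_{s\times t})=(1+o(1))\binom{n}{\le m-2}.$$ (b) If $n=sm$, then (i) for any $t\ge 3$, $$2^n-\mathrm{vex}(n,K_{s\times t})=(1+o(1))\Bigl[\binom{n}{m-1}-\binom{n-1}{m-1}+\binom{n}{\le m-2}\Bigr];$$ (ii) for $t=2$, there exists $\delta_s>0$ (depending only on $s$) such that $$\binom{n}{\le m-1}-(1+o(1))\beta_s\binom{n}{m-1}\ \ge\ 2^n-\mathrm{vex}(n,K_{s\times 2})\ \ge\ \binom{n}{\le m-1}-\Bigl(\frac{s-1}{s}-\delta_s+o(1)\Bigr)\binom{n}{m-1},$$ where $\beta_s=\frac{s-1}{s-2}\Bigl(1-\bigl(1-\frac{s-2}{s^2-s}\bigr)^{s-1}\Bigr)$.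
   Context: $[n]=\{1,\dots,n\}$, $2^{[n]}$ is the power set of $[n]$, and $\binom{n}{\le k}=\sum_{i=0}^{k}\binom{n}{i}$. The Kneser cube $\mathrm{Kn}_n$ is the graph with vertex set $2^{[n]}$ in which two distinct sets are adjacent iff they are disjoint. For a graph $G$, a family $\mathcal F\subseteq 2^{[n]}$ is $G$-free if the subgraph of $\mathrm{Kn}_n$ induced by $\mathcal F$ contains no (not necessarily induced) subgraph isomorphic to $G$, and $\mathrm{vex}(n,G)$ is the maximum size of a $G$-free family $\mathcal F\subseteq 2^{[n]}$. $K_{s\times t}$ denotes the complete $s$-partite graph with every part of size $t$; equivalently, $\mathcal F$ is $K_{s\times t}$-free iff it contains no $st$ distinct sets $F^j_i$ ($1\le j\le s$, $1\le i\le t$) such that the unions $\bigcup_{i=1}^t F^j_i$, $j=1,\dots,s$, are pairwise disjoint. *)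

(* Defs.v *)
From mathcomp Require Import all_boot all_order all_algebra.
From mathcomp Require Import all_classical all_reals all_analysis.

Set Implicit Arguments.
Unset Strict Implicit.
Unset Printing Implicit Defensive.

Import Order.TTheory GRing.Theory Num.Theory.
Import numFieldNormedType.Exports.

Local Open Scope nat_scope.

(* A finite simple graph is given by its adjacency relation, a symmetric and
   irreflexive [rel] on a [finType]. *)

(* The subgraph of [H] induced by [W] has a subgraph, not necessarily induced,
   isomorphic to [G]. *)
Definition contains_copy (U V : finType) (G : rel U) (H : rel V)
    (W : {set V}) : bool :=
  [exists f : {ffun U -> V},
    [&& injectiveb f, [forall x, f x \in W] &
        [forall x, forall y, G x y ==> H (f x) (f y)]]].

Definition kneser_cube (n : nat) : rel {set 'I_n} :=
  fun A B => (A != B) && [disjoint A & B].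

Definition complete_multipartite (s t : nat) : rel ('I_s * 'I_t) :=
  fun x y => x.1 != y.1.

Definition graph_free (U : finType) (n : nat) (G : rel U)
    (F : {set {set 'I_n}}) : bool :=
  ~~ contains_copy G (@kneser_cube n) F.

Definition vex (U : finType) (n : nat) (G : rel U) : nat :=
  \max_(F : {set {set 'I_n}} | graph_free G F) #|F|.

Definition binom_le (n k : nat) : nat := \sum_(i < k.+1) 'C(n, i).

Local Open Scope ring_scope.

Definition beta (R : realType) (s : nat) : R :=
  (s%:R - 1) / (s%:R - 2) *
  (1 - (1 - (s%:R - 2) / (s%:R ^+ 2 - s%:R)) ^+ (s - 1)%N).

Local Open Scope nat_scope.

Lemma kneser_cube_sym n : symmetric (@kneser_cube n).
Proof. by move=> A B; rewrite /kneser_cube eq_sym disjoint_sym. Qed.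

Lemma kneser_cube_irr n : irreflexive (@kneser_cube n).
Proof. by move=> A; rewrite /kneser_cube eqxx. Qed.

Lemma complete_multipartite_sym s t : symmetric (@complete_multipartite s t).
Proof. by move=> x y; rewrite /complete_multipartite eq_sym. Qed.

Lemma complete_multipartite_irr s t :
  irreflexive (@complete_multipartite s t).
Proof. by move=> x; rewrite /complete_multipartite eqxx. Qed.

(* Main.v *)
(** Call a set missing if it is not in the family F. For the upper bounds, take
    for F all sets of weight at least tau, where the weight of A is
    |A /\ X| + |A /\ Y| for suitable X and Y: a union of t distinct
    members of F has weight more than tau, and s disjoint sets cannot all do.

    For the lower bounds, call a set rich if at least t of the sets obtained by
    deleting a point are in F. A K_{s x t}-free family has no s disjoint rich
    sets, and an averaging argument along chains shows that the densities of the
    sets that are not rich sum to at least (n+1)/s over all levels. A level of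
    non-rich sets of density p forces the missing density one level below to be
    nearly p, and minimizing the missing mass subject to these constraints gives
    (a) and (b)(i), because the binomial coefficients increase.

    To gain the delta in (b)(ii), suppose that the missing densities of levels
    m-1 and m are close to 1/s and 0. Let h be the family of m-sets all of whose
    facets are missing. A random partition into s blocks of size m then has
    almost always exactly one block in h. Colour the points of a typical U in h
    at random with three colours and complete each colour class to a random
    m-set outside U; almost always exactly one of the completions is in h. A
    stability argument (a function of a random 3-colouring that is almost
    exactly-one-valued is close to a dictator) yields a pivot x in U such that a
    completion is in h essentially when it contains x. Two sets
    in h cannot have the same U \ x, so removing the pivot is injective: almost
    binom(n,m)/s, that is (s-1)/s * binom(n,m-1), sets of level m-1 are missing,
    and s >= 3 makes this exceed 1/s + delta. *)
Require Import Defs.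
From mathcomp Require Import all_classical all_reals all_analysis.
From mathcomp Require Import all_boot all_order all_algebra all_fingroup.
From mathcomp Require Import ring lra zify.

Set Implicit Arguments.
Unset Strict Implicit.
Unset Printing Implicit Defensive.

Import Order.TTheory GRing.Theory Num.Theory.
Import numFieldNormedType.Exports.

Local Open Scope ring_scope.

(** * Averages over finite types *)

Definition avg (R : realFieldType) (T : finType) (f : T -> R) : R :=
  (\sum_x f x) / #|T|%:R.

Section Avg.
Variable R : realFieldType.
Implicit Types T U : finType.

Lemma eq_avg T (f g : T -> R) : f =1 g -> avg f = avg g.
Proof. by move=> fg; rewrite /avg (eq_bigr g). Qed.

Lemma avgD T (f g : T -> R) : avg (fun x => f x + g x) = avg f + avg g.
Proof. by rewrite /avg big_split mulrDl. Qed.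

Lemma avgZ T (a : R) (f : T -> R) : avg (fun x => a * f x) = a * avg f.
Proof. by rewrite /avg -mulr_sumr mulrA. Qed.

Lemma avgZr T (a : R) (f : T -> R) : avg (fun x => f x * a) = avg f * a.
Proof. by rewrite mulrC -avgZ; apply: eq_avg => x; rewrite mulrC. Qed.

Lemma avgN T (f : T -> R) : avg (fun x => - f x) = - avg f.
Proof. by rewrite /avg sumrN mulNr. Qed.

Lemma avgB T (f g : T -> R) : avg (fun x => f x - g x) = avg f - avg g.
Proof. by rewrite avgD avgN. Qed.

Lemma avg_cst T (t : T) (a : R) : avg (fun _ : T => a) = a.
Proof.
have T0 : (#|T|%:R : R) != 0 by rewrite pnatr_eq0 -lt0n; apply/card_gt0P; exists t.
by rewrite /avg sumr_const -[a *+ _]mulr_natr mulfK.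
Qed.

Lemma ler_avg T (f g : T -> R) : (forall x, f x <= g x) -> avg f <= avg g.
Proof.
by move=> fg; rewrite /avg ler_wpM2r ?invr_ge0 ?ler0n //; apply: ler_sum.
Qed.

Lemma avg_ge0 T (f : T -> R) : (forall x, 0 <= f x) -> 0 <= avg f.
Proof. by move=> f0; rewrite /avg mulr_ge0 ?invr_ge0 ?ler0n ?sumr_ge0. Qed.

Lemma ler_norm_avg T (f : T -> R) : `|avg f| <= avg (fun x => `|f x|).
Proof.
by rewrite /avg normrM (@ger0_norm _ (_^-1)) ?invr_ge0 ?ler0n //
  ler_wpM2r ?invr_ge0 ?ler0n ?ler_norm_sum.
Qed.

Lemma exchange_avg T U (f : T -> U -> R) :
  avg (fun x => avg (f x)) = avg (fun y => avg (f^~ y)).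
Proof.
by rewrite /avg -!mulr_suml exchange_big /= -!mulrA [_^-1 * _]mulrC.
Qed.

Lemma avg_pair T U (f : T * U -> R) :
  avg f = avg (fun x => avg (fun y => f (x, y))).
Proof.
rewrite /avg -mulr_suml card_prod natrM invfM mulrA mulrAC; congr (_ * _ * _).
by rewrite pair_big; apply: eq_bigr => -[].
Qed.

Lemma reindex_avg T (h : T -> T) (f : T -> R) :
  injective h -> avg f = avg (fun x => f (h x)).
Proof.
by move=> hI; rewrite /avg (reindex_inj hI).
Qed.

Lemma avg_sum T (I : Type) (r : seq I) (P : pred I) (f : I -> T -> R) :
  avg (fun x => \sum_(i <- r | P i) f i x) = \sum_(i <- r | P i) avg (f i).
Proof. by rewrite /avg exchange_big mulr_suml. Qed.

Lemma avgM2 T U (f : T -> R) (g : U -> R) :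
  avg (fun x => avg (fun y => f x * g y)) = avg f * avg g.
Proof. by rewrite -avgZr; apply: eq_avg => x; rewrite avgZ. Qed.

End Avg.

(** * Uniform random three-colourings and resampling *)

Section Mix.
Variables (R : realFieldType) (I : finType).
Local Notation C := {ffun I -> 'I_3}.

Definition mix (V : {set I}) (x y : C) : C :=
  [ffun i => if i \in V then x i else y i].

Definition colour_class (c : C) (v : 'I_3) : {set I} := [set i | c i == v].

Lemma mix_swap_inj V : injective (fun p : C * C => (mix V p.1 p.2, mix V p.2 p.1)).
Proof.
move=> [x y] [x' y'] /= [/ffunP e1 /ffunP e2].
by congr (_, _); apply/ffunP => i; move: (e1 i) (e2 i); rewrite !ffunE; case: ifP.
Qed.

(** Exchanging the coordinates of [x] and [y] outside [V] permutes the pairs of colourings, so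
    gluing two independent uniform colourings gives a uniform one. *)
Lemma avg_mix V (f : C -> R) : avg (fun x => avg (fun y => f (mix V x y))) = avg f.
Proof.
rewrite -(avg_pair (fun p : C * C => f (mix V p.1 p.2))).
rewrite -(reindex_avg (fun p : C * C => f p.1) (@mix_swap_inj V)) avg_pair.
by apply: eq_avg => x /=; rewrite (avg_cst x).
Qed.

Lemma avg_coord (j : I) (f : 'I_3 -> R) : avg (fun c : C => f (c j)) = avg f.
Proof.
have shift w : avg (fun c : C => f (c j)) = avg (fun c : C => f (c j + w)).
  have sI : injective (fun c : C => [ffun i => c i + w] : C).
    by move=> c c' /ffunP e; apply/ffunP => i; have := e i; rewrite !ffunE => /addIr.
  by rewrite (reindex_avg _ sI); apply: eq_avg => c; rewrite ffunE.
rewrite -[LHS](avg_cst (ord0 : 'I_3)) (eq_avg shift) exchange_avg.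
have av (c : C) : avg (fun w => f (c j + w)) = avg f.
  by rewrite -(reindex_avg f (@addrI _ (c j))).
by rewrite (eq_avg av) (avg_cst ([ffun => ord0] : C)).
Qed.

Lemma avg_colour_class (f : {set I} -> R) v :
  avg (fun c : C => f (colour_class c v)) = avg (fun c : C => f (colour_class c 0)).
Proof.
have sI : injective (fun c : C => [ffun i => c i + v] : C).
  by move=> c c' /ffunP e; apply/ffunP => i; have := e i; rewrite !ffunE => /addIr.
rewrite (reindex_avg _ sI); apply: eq_avg => c; congr f; apply/setP => i.
by rewrite !inE ffunE -{2}[v]add0r (inj_eq (@addIr _ v)).
Qed.

(* Given two independent colourings [x] and [y], [kappa x y] is a uniform
   colouring with the same colour class [0] as [x], and exchanging [x] with [y]
   does not change its colour class [2]. *)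
Definition kappa (a b : 'I_3) : 'I_3 :=
  if a == 0 then 0 else if (b == 0) || (a == 1) && (b == 1) then 1 else 2%:R.

(** The difference [a - b] records what [kappa] forgets. The resulting bijection of the nine pairs
    is the change of variables behind [avg_kappa]. *)
Lemma kappa_inj (a b a' b' : 'I_3) :
  kappa a b = kappa a' b' -> a - b = a' - b' -> (a, b) = (a', b').
Proof.
move=> /eqP e1 /eqP e2; apply/eqP; move: a b a' b' e1 e2.
by do 4!(case=> [[|[|[|//]]] ?]).
Qed.

Lemma avg_kappa (s : {perm 'I_3}) (f : C -> R) :
  avg (fun x : C => avg (fun y : C => f [ffun i => s (kappa (x i) (y i))])) = avg f.
Proof.
rewrite -(avg_pair (fun p : C * C => f [ffun i => s (kappa (p.1 i) (p.2 i))])).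
have hI : injective (fun p : C * C =>
    ([ffun i => s (kappa (p.1 i) (p.2 i))] : C, [ffun i => p.1 i - p.2 i] : C)).
  move=> [x y] [x' y'] /= [/ffunP e1 /ffunP e2].
  have e i : (x i, y i) = (x' i, y' i).
    by apply: kappa_inj; [have := e1 i|have := e2 i]; rewrite !ffunE // => /perm_inj.
  by congr (_, _); apply/ffunP => i; case: (e i).
rewrite -(reindex_avg (fun p : C * C => f p.1) hI) avg_pair.
by apply: eq_avg => x /=; rewrite (avg_cst x).
Qed.

End Mix.

(** * Stability: functions of a random three-colouring close to a dictator *)

Definition rectangle (X Y : Type) (G : X -> Y -> bool) x x' y y' : bool :=
  (G x y + G x' y' == G x' y + G x y')%N.

(** Boolean values leave no room for two additive effects. If [G] changes between [x1] and [x2] at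
    [y1], and between [y2] and [y3] at [x3], two rectangles carry both changes to the corner
    [(x1, y2)], and a third one would then need the value 2 or -1 at [(x2, y3)]. So one of three
    rectangles fails, whence the factor 3. *)
Lemma rectangle_decouple (R : realFieldType) (X Y : finType) (x0 : X) (y0 : Y)
    (G : X -> Y -> bool) (rho : R) :
  avg (fun x => avg (fun x' => avg (fun y => avg (fun y' =>
    (~~ rectangle G x x' y y')%:R)))) <= rho ->
  avg (fun x => avg (fun x' => avg (fun y => (G x y != G x' y)%:R))) *
  avg (fun x => avg (fun y => avg (fun y' => (G x y != G x y')%:R))) <= 3 * rho :> R.
Proof.
set r := fun x x' y y' => (~~ rectangle G x x' y y')%:R : R.
move=> hr; set E2 := (X in _ * X <= _).
have -> : 3 * rho = rho + rho + rho by ring.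
apply: (@le_trans _ _ (avg (fun x1 => avg (fun x2 => avg (fun y1 =>
    avg (fun x3 => avg (fun y2 => avg (fun y3 =>
      r x1 x2 y1 y2 + r x3 x1 y2 y3 + r x1 x2 y2 y3)))))))).
  rewrite -avgZr; apply: ler_avg => x1; rewrite -avgZr; apply: ler_avg => x2.
  rewrite -avgZr; apply: ler_avg => y1; rewrite /E2 -avgZ; apply: ler_avg => x3.
  rewrite -avgZ; apply: ler_avg => y2; rewrite -avgZ; apply: ler_avg => y3.
  rewrite -natrM /r -!natrD ler_nat /rectangle.
  case: (G x1 y1); case: (G x2 y1); case: (G x1 y2); case: (G x2 y2);
  case: (G x3 y2); case: (G x3 y3); case: (G x1 y3); by case: (G x2 y3).
have -> : avg (fun x1 => avg (fun x2 => avg (fun y1 =>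
    avg (fun x3 => avg (fun y2 => avg (fun y3 =>
      r x1 x2 y1 y2 + r x3 x1 y2 y3 + r x1 x2 y2 y3)))))) =
  avg (fun x => avg (fun x' => avg (fun y => avg (r x x' y)))) +
  avg (fun x => avg (fun x' => avg (fun y => avg (r x x' y)))) +
  avg (fun x => avg (fun x' => avg (fun y => avg (r x x' y)))).
  rewrite [X in _ = _ + X + _]exchange_avg -!avgD; apply: eq_avg => x1.
  transitivity (avg (fun x2 =>
     avg (fun y1 => avg (r x1 x2 y1)) +
     avg (fun x3 => avg (fun y2 => avg (r x3 x1 y2))) +
     avg (fun y1 => avg (r x1 x2 y1)))); last first.
    by rewrite !avgD (avg_cst x0).
  apply: eq_avg => x2.
  transitivity (avg (fun y1 => avg (r x1 x2 y1) +
     avg (fun x3 => avg (fun y2 => avg (r x3 x1 y2))) +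
     avg (fun y1 => avg (r x1 x2 y1)))); last first.
    by rewrite !avgD !(avg_cst y0).
  apply: eq_avg => y1.
  transitivity (avg (fun x3 => avg (r x1 x2 y1) +
     (avg (fun y2 => avg (r x3 x1 y2))) +
     avg (fun y1 => avg (r x1 x2 y1)))); last first.
    by rewrite !avgD !(avg_cst x0).
  apply: eq_avg => x3.
  rewrite -!avgD; apply: eq_avg => y2.
  by rewrite !avgD !(avg_cst y0).
by rewrite !lerD.
Qed.

(** Here [u] and [v] stand for the probabilities of an event given that the pivot has colour 0,
    respectively another fixed colour. Small variances push both towards 0 or 1, and a mean near 1/3
    leaves only [u] near 1 and [v] near 0. *)
Lemma near_dictator (R : realFieldType) (u v eps : R) :
  0 <= u <= 1 -> 0 <= v <= 1 -> eps <= 1 / 20%:R ->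
  1 / 3 - eps <= (u + 2 * v) / 3 <= 1 / 3 + eps ->
  (2 * u * (1 - u) + 4 * v * (1 - v)) / 3 <= 2 * eps ->
  ((1 - u) + 2 * v) / 3 <= 2 * eps.
Proof.
move=> /andP[u0 u1] /andP[v0 v1] e20 /andP[pl pr] D.
(* A middle value of [v] makes the variance too large; a value above 7/10 makes the mean too
   large. *)
have vs : v <= 3 / 20%:R.
  have [//|vb] := leP v (3 / 20%:R); have [vm|vm] := leP v (7 / 10%:R); last by lra.
  have h1 : 0 <= (v - 3 / 20%:R) * (7 / 10%:R - v) by apply: mulr_ge0; lra.
  have h0 : 0 <= u * (1 - u) by apply: mulr_ge0; lra.
  nra.
have ub : 1 / 2 <= u by lra.
have h0 : 0 <= (u - 1 / 2) * (1 - u) by apply: mulr_ge0; lra.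
have h1 : 0 <= v * (1 / 2 - v) by apply: mulr_ge0; lra.
nra.
Qed.

Section Dictator.
Variables (R : realFieldType) (n : nat) (Phi : {set 'I_n} -> bool) (eta : R).
Local Notation C := {ffun 'I_n -> 'I_3}.

Definition one_class (c : C) : bool :=
  (\sum_(v < 3) Phi (colour_class c v) == 1)%N.

Hypothesis one_classP : avg (fun c : C => (~~ one_class c)%:R) <= eta.

Let G (c : C) := Phi (colour_class c 0).
Let c0 : C := [ffun => 0].

(** Take the four colourings obtained by exchanging [x] with [x'] on [V] and [y] with [y'] outside
    [V]. The first exchange preserves class 2 and the second preserves class 1, because [tau] swaps
    these colours outside [V]. If all four have exactly one good class, the alternating sum cancels
    classes 1 and 2 and leaves the rectangle identity for class 0. The factor 4 is a union bound. *)
Lemma rectangle_mix (V : {set 'I_n}) :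
  avg (fun x => avg (fun x' => avg (fun y => avg (fun y' =>
    (~~ rectangle (fun x y => G (mix V x y)) x x' y y')%:R)))) <= 4 * eta.
Proof.
pose tau : {perm 'I_3} := tperm 1 2%:R.
pose ka (x y : C) : C := [ffun i => (1%g : {perm 'I_3}) (kappa (x i) (y i))].
pose kb (x y : C) : C := [ffun i => tau (kappa (x i) (y i))].
pose bad c : R := (~~ one_class c)%:R.
have bad_avg : avg (fun x => avg (fun x' => avg (fun y => avg (fun y' =>
    bad (mix V (ka x x') (kb y y')))))) <= eta.
  apply: le_trans one_classP; rewrite le_eqVlt; apply/orP; left; apply/eqP.
  rewrite -[RHS](avg_mix V) -[RHS](avg_kappa 1%g).
  apply: eq_avg => x; apply: eq_avg => x'.
  by rewrite (avg_kappa tau (fun y => bad (mix V (ka x x') y))).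
apply: (@le_trans _ _ (avg (fun x => avg (fun x' => avg (fun y => avg (fun y' =>
    bad (mix V (ka x x') (kb y y')) + bad (mix V (ka x' x) (kb y y'))
    + bad (mix V (ka x x') (kb y' y)) + bad (mix V (ka x' x) (kb y' y)))))))).
  apply: ler_avg => x; apply: ler_avg => x'; apply: ler_avg => y; apply: ler_avg => y'.
  rewrite /bad -!natrD ler_nat /rectangle /one_class !big_ord_recl !big_ord0 /G.
  rewrite (_ : lift ord0 ord0 = 1); last exact/val_inj.
  rewrite (_ : lift ord0 (lift ord0 ord0) = 2%:R); last exact/val_inj.
  have tau_id (a : 'I_3) : (1%g : {perm 'I_3}) a = a by rewrite perm1.
  have tauE (a : 'I_3) : tau a = if a == 1 then 2%:R else if a == 2%:R then 1 else a.
    by rewrite permE.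
  have k0 a b : (kappa a b == 0) = (a == 0) by move: a b; do 2!case=> [[|[|[|//]]] ?].
  have kt0 a b : (tau (kappa a b) == 0) = (a == 0).
    by rewrite tauE; move: a b; do 2!case=> [[|[|[|//]]] ?].
  have k2 a b : (kappa a b == 2%:R) = (kappa b a == 2%:R).
    by move: a b; do 2!case=> [[|[|[|//]]] ?].
  have kt1 a b : (tau (kappa a b) == 1) = (tau (kappa b a) == 1).
    by rewrite !tauE; move: a b; do 2!case=> [[|[|[|//]]] ?].
  have z x1 x2 y1 y2 : colour_class (mix V (ka x1 x2) (kb y1 y2)) 0 =
                       colour_class (mix V x1 y1) 0.
    by apply/setP => i; rewrite !inE !ffunE; case: ifP; rewrite ?tau_id ?k0 ?kt0.
  have two x1 x2 y1 y2 : colour_class (mix V (ka x1 x2) (kb y1 y2)) 2%:R =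
                         colour_class (mix V (ka x2 x1) (kb y1 y2)) 2%:R.
    by apply/setP => i; rewrite !inE !ffunE; case: ifP; rewrite ?tau_id // k2.
  have one x1 x2 y1 y2 : colour_class (mix V (ka x1 x2) (kb y1 y2)) 1 =
                         colour_class (mix V (ka x1 x2) (kb y2 y1)) 1.
    by apply/setP => i; rewrite !inE !ffunE; case: ifP; rewrite ?tau_id // kt1.
  rewrite !z (one x x' y' y) (one x' x y' y) (two x' x y y') (two x' x y' y).
  case: (Phi _); case: (Phi _); case: (Phi _); case: (Phi _);
  case: (Phi _); case: (Phi _); case: (Phi _); by case: (Phi _).
have -> : avg (fun x => avg (fun x' => avg (fun y => avg (fun y' =>
    bad (mix V (ka x x') (kb y y')) + bad (mix V (ka x' x) (kb y y'))
    + bad (mix V (ka x x') (kb y' y)) + bad (mix V (ka x' x) (kb y' y)))))) =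
  4 * avg (fun x => avg (fun x' => avg (fun y => avg (fun y' =>
    bad (mix V (ka x x') (kb y y')))))).
  set r := fun x x' y y' => bad (mix V (ka x x') (kb y y')).
  set E := (X in _ = _ * X).
  transitivity (avg (fun x => avg (fun x' => avg (fun y => avg (r x x' y))))
    + avg (fun x => avg (fun x' => avg (fun y => avg (r x' x y))))
    + avg (fun x => avg (fun x' => avg (fun y => avg (fun y' => r x x' y' y))))
    + avg (fun x => avg (fun x' => avg (fun y => avg (fun y' => r x' x y' y))))).
    rewrite -!avgD; apply: eq_avg => x; rewrite -!avgD; apply: eq_avg => x'.
    by rewrite -!avgD; apply: eq_avg => y; rewrite -!avgD.
  have sw f : avg (fun y : C => avg (fun y' : C => f y' y)) =
              avg (fun y => avg (f y)) :> R by rewrite exchange_avg.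
  have -> : avg (fun x => avg (fun x' => avg (fun y => avg (r x' x y)))) = E.
    by rewrite exchange_avg.
  have e3 : avg (fun x => avg (fun x' => avg (fun y => avg (fun y' => r x x' y' y)))) = E.
    by apply: eq_avg => x; apply: eq_avg => x'; rewrite exchange_avg.
  rewrite e3 (sw (fun x x' => avg (fun y => avg (fun y' => r x x' y' y)))) e3 /E; ring.
by rewrite ler_pM2l.
Qed.

(** Reveal the coordinates one by one: [e k] measures the dependence on the first [k] coordinates,
    [J k] the dependence on the others, and their product is at most [12 * eta]. The coordinate at
    which [e] first exceeds [eps] is the dictator. The second conclusion serves later to place the
    pivot inside [U]. *)
Lemma dictator (eps : R) : 0 < eps -> eps <= 1 / 20%:R -> 12%:R * eta <= eps ^+ 2 ->
  exists j : 'I_n,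
    avg (fun c : C => (Phi (colour_class c 0) != (c j == 0))%:R) <= 2 * eps /\
    exists c c' : C, (forall i, i != j -> c i = c' i) /\
      Phi (colour_class c 0) != Phi (colour_class c' 0).
Proof.
move=> eps0 eps20 etaeps.
pose V k := [set i : 'I_n | (i < k)%N].
pose e k : R := avg (fun c => avg (fun c' => (G c != G (mix (V k) c' c))%:R)).
pose J k : R := avg (fun c => avg (fun c' => (G c != G (mix (V k) c c'))%:R)).
have eE k : avg (fun x => avg (fun x' => avg (fun y =>
    (G (mix (V k) x y) != G (mix (V k) x' y))%:R))) = e k.
  rewrite /e -[RHS](avg_mix (V k)); apply: eq_avg => x; rewrite exchange_avg.
  apply: eq_avg => y; apply: eq_avg => x'; do 3!congr (_ _); congr (_ == G _).
  by apply/ffunP => i; rewrite !ffunE; case: ifP.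
have JE k : avg (fun x => avg (fun y => avg (fun y' =>
    (G (mix (V k) x y) != G (mix (V k) x y'))%:R))) = J k.
  rewrite /J -[RHS](avg_mix (V k)); apply: eq_avg => x.
  apply: eq_avg => y; apply: eq_avg => x'; do 3!congr (_ _); congr (_ == G _).
  by apply/ffunP => i; rewrite !ffunE; case: ifP.
have eJ k : e k * J k <= eps ^+ 2.
  apply: le_trans etaeps; rewrite -eE -JE.
  have -> : 12%:R * eta = 3 * (4 * eta) by ring.
  exact: (rectangle_decouple c0 c0 (rectangle_mix (V k))).
pose p : R := avg (fun c => (G c)%:R).
have p3 : `|3 * p - 1| <= 2 * eta.
  have -> : 3 * p - 1 = avg (fun c : C =>
      \sum_(v < 3) (Phi (colour_class c v))%:R - 1).
    rewrite avgB (avg_cst c0) avg_sum; congr (_ - _).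
    rewrite (eq_bigr (fun=> p)) => [|v _]; last first.
      by rewrite (avg_colour_class (fun A => (Phi A)%:R)).
    by rewrite sumr_const card_ord mulr_natl.
  apply: le_trans (ler_norm_avg _) _.
  apply: le_trans (_ : avg (fun c : C => 2 * (~~ one_class c)%:R) <= _); last first.
    by rewrite avgZ ler_pM2l.
  apply: ler_avg => c; rewrite /one_class !big_ord_recl !big_ord0.
  case: (Phi _); case: (Phi _); case: (Phi _) => //=;
    rewrite ?addr0 ?add0r ?subrr ?normr0 ?mulr1 ?mulr0 //=; by rewrite ler_norml; lra.
(* Resampling all coordinates gives an independent colouring; since [p] is close to 1/3, this
   dependence exceeds [eps]. *)
have en : e n = 2 * p * (1 - p).
  transitivity (avg (fun c => (G c)%:R * (1 - p) + (1 - (G c)%:R) * p)).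
    apply: eq_avg => c.
    rewrite (eq_avg (g := fun c' => (G c)%:R * (1 - (G c')%:R) + (1 - (G c)%:R) * (G c')%:R)).
      by rewrite avgD !avgZ avgB (avg_cst c0).
    move=> c'; have -> : mix (V n) c' c = c' by apply/ffunP => i; rewrite ffunE inE ltn_ord.
    by case: (G c); case: (G c') => /=; ring.
  rewrite avgD !avgZr avgB (avg_cst c0) -/p; ring.
have eta0 : 0 <= eta by apply: le_trans one_classP; apply: avg_ge0 => c; exact: ler0n.
have eps400 : eps ^+ 2 <= 1 / 400%:R by rewrite expr2; nra.
have pbd : 1 / 3 - eps <= p /\ p <= 1 / 3 + eps.
  by move: p3; rewrite ler_norml => /andP[]; rewrite expr2 in etaeps; split; nra.
have en_big : eps < e n by rewrite en; nra.
have e0 : e 0%N = 0.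
  rewrite /e (eq_avg (g := fun=> 0)) ?(avg_cst c0) // => c.
  rewrite (eq_avg (g := fun=> 0)) ?(avg_cst c0) // => c'.
  have -> : mix (V 0%N) c' c = c by apply/ffunP => i; rewrite ffunE inE.
  by rewrite eqxx.
have [k ek kmin] := ex_minnP (ex_intro (fun k => eps < e k) n en_big).
have kn : (k <= n)%N by apply: kmin.
case: k => [|k] in ek kmin kn; first by rewrite e0 ltNge (ltW eps0) in ek.
pose j := Ordinal kn.
have ekle : e k <= eps by rewrite leNgt; apply/negP => /kmin; rewrite ltnn.
have Jk : J k.+1 <= eps.
  have := eJ k.+1; have J0 : 0 <= J k.+1 by do 2!(apply: avg_ge0 => ?); exact: ler0n.
  by rewrite expr2; nra.
(* Keep coordinate [j] and resample the others: those before [j] cost [e k], those after it cost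
   [J k.+1]. *)
have Dle : avg (fun c => avg (fun c' => (G c != G (mix [set j] c c'))%:R)) <= 2 * eps.
  apply: (@le_trans _ _ (e k + J k.+1)); last by lra.
  have -> : J k.+1 = avg (fun c => avg (fun c' =>
      (G (mix (V k) c' c) != G (mix [set j] c c'))%:R)).
    rewrite /J -(avg_pair (fun q : C * C => (G q.1 != G (mix (V k.+1) q.1 q.2))%:R)).
    pose h (q : C * C) := (mix (V k) q.2 q.1, mix (V k) q.1 q.2).
    have hI : injective h.
      have -> : h = (fun p : C * C => (mix (V k) p.1 p.2, mix (V k) p.2 p.1)) \o
                    (fun p => (p.2, p.1)) by [].
      by apply: inj_comp (@mix_swap_inj _ _) _ => -[? ?] [? ?] [-> ->].
    rewrite (reindex_avg _ hI) avg_pair; apply: eq_avg => c; apply: eq_avg => c'.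
    do 3!congr (_ _); congr (_ == G _); apply/ffunP => i; rewrite !ffunE !inE.
    by rewrite -val_eqE /= ltnS leq_eqVlt; case: ltngtP.
  rewrite -avgD; apply: ler_avg => c; rewrite -avgD; apply: ler_avg => c'.
  rewrite -natrD ler_nat.
  by case: (G c); case: (G (mix (V k) c' c)); case: (G (mix [set j] c c')).
exists j; split; last first.
  have [/existsP[c /existsP[c' /andP[/forallP cc' Gcc']]]|/existsPn noG] :=
    boolP [exists c : C, exists c' : C,
      [forall i, (i != j) ==> (c i == c' i)] && (G c != G c')].
    by exists c, c'; split=> // i ij; apply/eqP; exact: (implyP (cc' i)).
  (* If a change at [j] alone never mattered, [e] would not grow from [k] to [k.+1]. *)
  move: ek; rewrite ltNge (_ : e k.+1 = e k) ?ekle //.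
  apply: eq_avg => c; apply: eq_avg => c'; do 3!congr (_ _); congr (_ == _).
  have /existsPn/(_ (mix (V k) c' c)) := noG (mix (V k.+1) c' c).
  rewrite negb_and negbK => /orP[/negP[]|/eqP //].
  apply/forallP => i; apply/implyP; rewrite -val_eqE /= => ij.
  by rewrite !ffunE !inE ltnS leq_eqVlt (negbTE ij).
pose upd (c : C) v : C := [ffun i => if i == j then v else c i].
have updE (f : C -> R) : avg f = avg (fun v => avg (fun c => f (upd c v))).
  rewrite -(avg_coord j) -[LHS](avg_mix [set j]); apply: eq_avg => x; apply: eq_avg => y.
  by congr f; apply/ffunP => i; rewrite !ffunE inE; case: eqP => // ->.
pose u v : R := avg (fun c => (G (upd c v))%:R).
(* [G] sees only the class of colour 0, so colours 1 and 2 at [j] are interchangeable and two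
   conditional probabilities suffice. *)
have G2 c : G (upd c 1) = G (upd c 2%:R).
  by congr (Phi _); apply/setP => i; rewrite !inE !ffunE; case: ifP.
have avg3 (f : 'I_3 -> R) : avg f = (f 0 + f 1 + f 2%:R) / 3.
  rewrite /avg card_ord !big_ord_recl big_ord0 addr0 addrA; congr ((_ + f _ + f _) / _);
  exact: val_inj.
have u12 : u 2%:R = u 1 by apply: eq_avg => c; rewrite G2.
have u01 v : 0 <= u v <= 1.
  rewrite avg_ge0 => [|c]; last exact: ler0n.
  rewrite -[X in _ <= X](avg_cst c0); apply: ler_avg => c.
  by rewrite -[1]/(1%:R) ler_nat leq_b1.
have pu : p = (u 0 + 2 * u 1) / 3 by rewrite /p updE avg3 -/(u 0) -/(u 1) -/(u 2%:R) u12; ring.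
have Du : (2 * u 0 * (1 - u 0) + 4 * u 1 * (1 - u 1)) / 3 <= 2 * eps.
  apply: le_trans Dle; rewrite updE.
  rewrite (eq_avg (g := fun v => 2 * u v * (1 - u v))) => [|v].
    by rewrite avg3 u12 le_eqVlt; apply/orP; left; apply/eqP; field.
  transitivity (avg (fun c => (G (upd c v))%:R * (1 - u v) + (1 - (G (upd c v))%:R) * u v)).
    apply: eq_avg => c.
    rewrite (eq_avg (g := fun c' => (G (upd c v))%:R * (1 - (G (upd c' v))%:R)
       + (1 - (G (upd c v))%:R) * (G (upd c' v))%:R)).
      by rewrite avgD !avgZ avgB (avg_cst c0).
    move=> c'; have -> : mix [set j] (upd c v) c' = upd c' v.
      by apply/ffunP => i; rewrite !ffunE inE; case: eqP => // ->; rewrite eqxx.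
    by case: (G (upd c v)); case: (G (upd c' v)) => /=; ring.
  rewrite avgD !avgZr avgB (avg_cst c0) -/(u v); ring.
have -> : avg (fun c : C => (Phi (colour_class c 0) != (c j == 0))%:R) =
    ((1 - u 0) + 2 * u 1) / 3.
  rewrite updE avg3; congr (_ / _).
  have -> : avg (fun c : C => (Phi (colour_class (upd c 0) 0) != (upd c 0 j == 0))%:R)
      = 1 - u 0.
    rewrite /u -[X in X - _](avg_cst c0) -avgB; apply: eq_avg => c.
    by rewrite ffunE !eqxx -/(G _); case: (G _) => /=; rewrite ?subrr ?subr0.
  rewrite mulr2n mulrDl !mul1r -addrA; congr (_ + _).
  congr (_ + _); last rewrite -u12; apply: eq_avg => c;
    by rewrite ffunE eqxx -/(G _); case: (G _).
have /andP pbd' := pbd; rewrite pu in pbd'.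
exact: (near_dictator (u01 0) (u01 1) eps20 pbd' Du).
Qed.

End Dictator.

(** * Averages over permutations and over levels of the cube *)

Section SymAverages.
Variables (R : realFieldType) (T : finType).
Implicit Types (Y A B : {set T}) (phi : {set T} -> R) (k : nat).

Definition level_avg Y k phi : R :=
  (\sum_(B : {set T} | (B \subset Y) && (#|B| == k)) phi B) / 'C(#|Y|, k)%:R.

Definition sym_avg Y (psi : {perm T} -> R) : R :=
  (\sum_(p : {perm T} | perm_on Y p) psi p) / #|perm_on Y|%:R.

(** A transposition of a point of [A :\: B] with a point of [B :\: A] shrinks the difference;
    iterate. *)
Lemma perm_on_transitive Y A B : A \subset Y -> B \subset Y -> #|A| = #|B| ->
  exists2 p : {perm T}, perm_on Y p & p @: A = B.
Proof.
have [N] := ubnP #|A :\: B|; elim: N A => // N IH A; rewrite ltnS => ltN AY BY cAB.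
have [AB|/set0Pn[x]] := eqVneq (A :\: B) set0.
  exists 1%g; first exact: perm_on1.
  rewrite (eq_imset (g := id)) ?imset_id => [|x]; last by rewrite perm1.
  by apply/eqP; rewrite eqEcard cAB leqnn andbT -setD_eq0 AB.
rewrite inE => /andP[xB xA].
have /set0Pn[y] : B :\: A != set0.
  apply: contraL xA => /eqP BA; have : B == A by rewrite eqEcard -setD_eq0 BA eqxx cAB leqnn.
  by move=> /eqP <-.
rewrite inE => /andP[yA yB].
pose t := tperm x y.
have tA : t @: A = y |: (A :\ x).
  apply/setP => z; rewrite -{1}[z](tpermK x y) mem_imset; last exact: perm_inj.
  rewrite !inE; case: tpermP => [->|->|/eqP zx /eqP zy].
  - by rewrite eqxx andFb orbF (negbTE yA); case: eqP yA => [<-|//]; rewrite xA.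
  - by rewrite eqxx xA.
  - by rewrite zx (negbTE zy).
have tY : perm_on Y t.
  apply/subsetP => z; rewrite inE; case: tpermP => [->|->|]; last by rewrite eqxx.
  - by rewrite (subsetP AY).
  - by rewrite (subsetP BY).
have c1 : #|t @: A| = #|A| by apply: card_imset; exact: perm_inj.
have lt1 : (#|(t @: A) :\: B| < N)%N.
  rewrite tA; apply: leq_trans ltN; apply: proper_card; apply/properP; split.
    apply/subsetP => z; rewrite !inE => /andP[zB /orP[/eqP zy|/andP[_ ->]]].
      by rewrite zy yB in zB.
    by rewrite zB.
  by exists x; rewrite !inE ?xA ?xB // eqxx /= orbF; apply: contraNN xB => /eqP->.
have tAY : t @: A \subset Y.
  by apply/subsetP => z /imsetP[w wA ->]; rewrite (perm_closed _ tY) (subsetP AY).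
have [p pY pE] := IH _ lt1 tAY BY (etrans c1 cAB).
exists (t * p)%g; first exact: perm_onM.
by rewrite -pE -imset_comp; apply: eq_imset => z; rewrite /= permM.
Qed.

(** By transitivity the sum over permutations is the same for all sets of the size of [B] inside
    [Y]; summing over these sets as well and exchanging the sums shows that the image of [B] is
    uniform. *)
Lemma sym_avg_imset Y B phi : B \subset Y ->
  sym_avg Y (fun p => phi (p @: B)) = level_avg Y #|B| phi.
Proof.
move=> BY.
have trans B' : (B' \subset Y) && (#|B'| == #|B|) ->
    \sum_(p : {perm T} | perm_on Y p) phi (p @: B') =
    \sum_(p : {perm T} | perm_on Y p) phi (p @: B).
  move=> /andP[B'Y /eqP cB]; have [q qY <-] := perm_on_transitive BY B'Y (esym cB).
  rewrite [RHS](reindex_inj (mulgI q)) /=; apply: eq_big => p.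
    apply/idP/idP => [|pq]; first exact: perm_onM.
    by rewrite -(mulKg q p) perm_onM ?perm_onV.
  by move=> _; congr phi; rewrite -imset_comp; apply: eq_imset => z; rewrite /= permM.
have C0 : ('C(#|Y|, #|B|)%:R : R) != 0.
  by rewrite pnatr_eq0 -lt0n bin_gt0 subset_leq_card.
have P0 : (#|perm_on Y|%:R : R) != 0.
  by rewrite pnatr_eq0 -lt0n card_perm fact_gt0.
rewrite /sym_avg /level_avg; apply/eqP; rewrite eqr_div //; apply/eqP.
transitivity (\sum_(B' : {set T} | (B' \subset Y) && (#|B'| == #|B|))
    \sum_(p : {perm T} | perm_on Y p) phi (p @: B')).
  rewrite (eq_bigr _ trans) sumr_const mulr_natr; congr (_ *+ _).
  by rewrite -cards_draws cardsE.
rewrite exchange_big /= (eq_bigr (fun=> \sum_(B' : {set T} | (B' \subset Y) && (#|B'| == #|B|)) phi B')).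
  by rewrite sumr_const mulr_natr.
move=> p pY; rewrite [RHS](reindex_inj (imset_inj (@perm_inj _ p))).
apply: eq_bigl => B'; rewrite card_imset; last exact: perm_inj.
congr (_ && _); apply/idP/idP => /subsetP sub; apply/subsetP => z.
  by move=> /imsetP[w /sub wY ->]; rewrite (perm_closed _ pY).
by move=> zB; rewrite -(perm_closed _ pY) sub // imset_f.
Qed.

Lemma avg_imset B phi :
  avg (fun p : {perm T} => phi (p @: B)) = level_avg setT #|B| phi.
Proof.
rewrite -sym_avg_imset ?subsetT // /avg /sym_avg.
have on p : perm_on [set: T] p by apply/subsetP => x; rewrite inE.
congr (_ / _%:R); first by apply: eq_bigl => p; rewrite on.
by apply: eq_card => p; rewrite [RHS]on.
Qed.

Lemma level_avg_imset (g : {perm T}) Y k phi :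
  level_avg (g @: Y) k phi = level_avg Y k (fun B => phi (g @: B)).
Proof.
rewrite /level_avg card_imset; last exact: perm_inj.
rewrite (reindex_inj (imset_inj (@perm_inj _ g))); congr (_ / _).
apply: eq_bigl => B; rewrite card_imset; last exact: perm_inj.
congr (_ && _); apply/idP/idP => [/subsetP sub|]; last exact: imsetS.
by apply/subsetP => z zB; rewrite -(mem_imset _ _ (@perm_inj _ g)) sub ?imset_f.
Qed.

Section Linear.
Variables (Y : {set T}).

Lemma sym_avgD psi1 psi2 :
  sym_avg Y (fun p => psi1 p + psi2 p) = sym_avg Y psi1 + sym_avg Y psi2.
Proof. by rewrite /sym_avg big_split mulrDl. Qed.

Lemma sym_avg_cst (a : R) : sym_avg Y (fun=> a) = a.
Proof.
have P0 : (#|perm_on Y|%:R : R) != 0.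
  by rewrite pnatr_eq0 -lt0n card_perm fact_gt0.
by rewrite /sym_avg sumr_const -[a *+ _]mulr_natr mulfK.
Qed.

Lemma ler_norm_sym_avg psi : `|sym_avg Y psi| <= sym_avg Y (fun p => `|psi p|).
Proof.
by rewrite /sym_avg normrM (@ger0_norm _ (_^-1)) ?invr_ge0 ?ler0n //
  ler_wpM2r ?invr_ge0 ?ler0n ?ler_norm_sum.
Qed.

Lemma sym_avgZ a psi : sym_avg Y (fun p => a * psi p) = a * sym_avg Y psi.
Proof. by rewrite /sym_avg -mulr_sumr mulrA. Qed.

Lemma eq_sym_avg psi1 psi2 : (forall p, perm_on Y p -> psi1 p = psi2 p) ->
  sym_avg Y psi1 = sym_avg Y psi2.
Proof. by move=> e; rewrite /sym_avg (eq_bigr _ e). Qed.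

(** A uniform permutation stays uniform after composition with one supported on [Y]. This permits
    re-randomizing the points of [Y] while the others keep their images. *)
Lemma avg_sym_avg (psi : {perm T} -> R) :
  avg (fun g => sym_avg Y (fun p => psi (p * g)%g)) = avg psi.
Proof.
transitivity (sym_avg Y (fun p => avg (fun g => psi (p * g)%g))).
  by rewrite /avg /sym_avg -!mulr_suml exchange_big /= -!mulrA [_^-1 * _]mulrC.
rewrite -[RHS]sym_avg_cst; apply: eq_sym_avg => p _.
by rewrite -(reindex_avg psi (mulgI p)).
Qed.

Lemma eq_level_avg k phi1 phi2 :
  (forall B, B \subset Y -> #|B| = k -> phi1 B = phi2 B) ->
  level_avg Y k phi1 = level_avg Y k phi2.
Proof.
by move=> e; congr (_ / _); apply: eq_bigr => B /andP[BY /eqP]; exact: e.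
Qed.

Lemma ler_level_avg k phi1 phi2 :
  (forall B, B \subset Y -> #|B| = k -> phi1 B <= phi2 B) ->
  level_avg Y k phi1 <= level_avg Y k phi2.
Proof.
move=> e; rewrite /level_avg ler_wpM2r ?invr_ge0 ?ler0n //.
by apply: ler_sum => B /andP[BY /eqP]; exact: e.
Qed.

Lemma level_avg_cst k (a : R) : (k <= #|Y|)%N -> level_avg Y k (fun=> a) = a.
Proof.
move=> kY; have C0 : ('C(#|Y|, k)%:R : R) != 0 by rewrite pnatr_eq0 -lt0n bin_gt0.
rewrite /level_avg sumr_const -[a *+ _]mulr_natr -cards_draws cardsE.
by rewrite mulfK // -cardsE cards_draws.
Qed.

Lemma level_avgZ k a phi : level_avg Y k (fun B => a * phi B) = a * level_avg Y k phi.
Proof. by rewrite /level_avg -mulr_sumr mulrA. Qed.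

Lemma level_avgD k phi1 phi2 :
  level_avg Y k (fun B => phi1 B + phi2 B) = level_avg Y k phi1 + level_avg Y k phi2.
Proof. by rewrite /level_avg big_split mulrDl. Qed.

Lemma avg_level_avg (U : finType) k (f : U -> {set T} -> R) :
  avg (fun x => level_avg Y k (f x)) = level_avg Y k (fun B => avg (f^~ B)).
Proof.
by rewrite /avg /level_avg -!mulr_suml exchange_big /= -!mulrA [_^-1 * _]mulrC.
Qed.

End Linear.
End SymAverages.

Lemma subset_of_card (T : finType) (Y : {set T}) (k : nat) : (k <= #|Y|)%N ->
  exists2 B : {set T}, B \subset Y & #|B| = k.
Proof.
rewrite -bin_gt0 -cards_draws => /card_gt0P[B]; rewrite inE => /andP[BY /eqP Bk].
by exists B.
Qed.

Lemma disjointsU (T : finType) (A B C : {set T}) :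
  [disjoint A :|: B & C] = [disjoint A & C] && [disjoint B & C].
Proof. by rewrite -!setI_eq0 setIUl setU_eq0. Qed.

Lemma card_disjointU (T : finType) (A B : {set T}) :
  [disjoint A & B] -> #|A :|: B| = (#|A| + #|B|)%N.
Proof. by rewrite -setI_eq0 => /eqP AB; rewrite cardsU AB cards0 subn0. Qed.

Lemma leq_sub_pair (a b l : nat) : (l - a <= l + l - (l - b))%N.
Proof. by lia. Qed.

Lemma leq_sub_triple (a b c l : nat) : (a + b + c = l -> l - c <= l + l - (l - a + (l - b)))%N.
Proof. by lia. Qed.

Lemma imset_permC (T : finType) (g : {perm T}) (A : {set T}) : g @: (~: A) = ~: (g @: A).
Proof.
apply/setP => x; rewrite -[x](permKV g) inE !mem_imset ?inE //; exact: perm_inj.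
Qed.

Lemma imset_perm_id (T : finType) (A : {set T}) (g : {perm T}) :
  perm_on (~: A) g -> g @: A = A.
Proof.
move=> gA; rewrite (eq_in_imset (g := id)) ?imset_id // => x xA.
by rewrite (out_perm gA) // inE xA.
Qed.

(** * Random completions to sets of size m *)

Section SetAverage.
Variables (R : realFieldType) (n m : nat) (h : pred {set 'I_n}).

(* The probability that [A], completed to an [m]-set by random points outside
   [U], satisfies [h]. *)
Definition fill_prob (U A : {set 'I_n}) : R :=
  level_avg (~: U) (m - #|A|) (fun B => (h (A :|: B))%:R).

Implicit Types U A B : {set 'I_n}.

Lemma fill_prob_imset (g : {perm 'I_n}) U A :
  fill_prob (g @: U) (g @: A) =
  level_avg (~: U) (m - #|A|) (fun B => (h (g @: (A :|: B)))%:R).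
Proof.
rewrite /fill_prob -imset_permC level_avg_imset card_imset; last exact: perm_inj.
by apply: eq_level_avg => B _ _; rewrite imsetU.
Qed.

Lemma fill_prob_sym (g : {perm 'I_n}) U A B : A \subset U -> B \subset ~: U ->
  #|B| = (m - #|A|)%N ->
  fill_prob (g @: U) (g @: A) =
  sym_avg (~: U) (fun p => (h ((p * g)%g @: (A :|: B)))%:R).
Proof.
move=> AU BU cB; rewrite fill_prob_imset -cB -sym_avg_imset //.
apply: eq_sym_avg => p pU; congr (h _)%:R.
have pA : p @: A = A.
  by apply: imset_perm_id; apply: (subset_trans pU); rewrite setCS.
rewrite -{1}pA -imsetU -imset_comp; apply: eq_imset => x.
by rewrite /= permM.
Qed.

Lemma fill_prob_ge0 U A : 0 <= fill_prob U A.
Proof. by rewrite /fill_prob /level_avg mulr_ge0 ?invr_ge0 ?ler0n ?sumr_ge0. Qed.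

Lemma fill_prob_le1 U A : (m - #|A| <= #|~: U|)%N -> fill_prob U A <= 1.
Proof.
move=> le; rewrite -(level_avg_cst 1 le); apply: ler_level_avg => B _ _.
by rewrite -[1]/(1%:R) ler_nat leq_b1.
Qed.

End SetAverage.

(** * Partitions with almost always exactly one block in h *)

Section ExactlyOne.
Variables (R : realFieldType) (n m k : nat) (h : pred {set 'I_n}) (eta : R).
Hypothesis nE : n = (k.+3 * m)%N.
Implicit Types X Y A B : {set 'I_n}.

Definition is_block_partition (P : 'I_k.+3 -> {set 'I_n}) : Prop :=
  (forall i, #|P i| = m) /\ (forall i j, i != j -> [disjoint P i & P j]).

Hypothesis exactly_one : forall P, is_block_partition P ->
  avg (fun g : {perm 'I_n} => (\sum_i h (g @: P i) != 1)%N%:R) <= eta.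

Variable S : 'I_k.+3 -> {set 'I_n}.
Hypothesis S_part : is_block_partition S.

Local Notation S0 := (S ord0).
Local Notation S1 := (S (lift ord0 ord0)).
Local Notation S2 := (S (lift ord0 (lift ord0 ord0))).

(** Two such partitions with the same [p] differ only in their first three blocks. *)
Definition three_blocks (p : {perm 'I_n}) (X0 X1 X2 : {set 'I_n}) (i : 'I_k.+3) :=
  match val i with 0 => X0 | 1 => X1 | 2 => X2 | _ => p @: S i end.

Lemma sum_three_blocks p X0 X1 X2 (phi : {set 'I_n} -> nat) :
  (\sum_i phi (three_blocks p X0 X1 X2 i) = phi X0 + phi X1 + phi X2 +
    \sum_(i < k) phi (p @: S (lift ord0 (lift ord0 (lift ord0 i)))))%N.
Proof. by rewrite !big_ord_recl /= !addnA. Qed.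

Lemma three_blocks_part (p : {perm 'I_n}) X0 X1 X2 :
  #|X0| = m -> #|X1| = m -> #|X2| = m ->
  [disjoint X0 & X1] -> [disjoint X0 & X2] -> [disjoint X1 & X2] ->
  X0 :|: X1 :|: X2 \subset p @: (S0 :|: S1 :|: S2) ->
  is_block_partition (three_blocks p X0 X1 X2).
Proof.
have [cS dS] := S_part.
move=> c0 c1 c2 d01 d02 d12; rewrite !subUset => /andP[/andP[s0 s1] s2].
have dis X (i : 'I_k.+3) : (2 < i)%N -> X \subset p @: (S0 :|: S1 :|: S2) ->
    [disjoint X & p @: S i].
  move=> i2 sX; apply: disjointWl sX _.
  rewrite imset_disjoint; last exact: perm_inj.
  rewrite !disjointsU !dS //; by apply/eqP => e; move: i2; rewrite -e.
split=> [[[|[|[|i]]] ilt] //|].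
  by rewrite /three_blocks /= (card_imset _ (@perm_inj _ p)) cS.
move=> [[|[|[|i]]] ilt] [[|[|[|j]]] jlt]; rewrite /three_blocks -?val_eqE //= => ij;
  try by [|rewrite disjoint_sym|exact: dis|rewrite disjoint_sym; exact: dis].
rewrite imset_disjoint; last exact: perm_inj.
by apply: dS; rewrite -val_eqE.
Qed.

(* Compare a partition starting with [S0] and one in which [X0], [X1], [X2]
   replace its first three blocks: if [S0] is the only set satisfying [h] in
   the former, then the common blocks do not satisfy [h]. *)
Lemma resplit X0 X1 X2 :
  #|X0| = m -> #|X1| = m -> #|X2| = m ->
  [disjoint X0 & X1] -> [disjoint X0 & X2] -> [disjoint X1 & X2] ->
  S0 \subset X0 :|: X1 :|: X2 ->
  avg (fun g : {perm 'I_n} => (h (g @: S0) &&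
    (h (g @: X0) + h (g @: X1) + h (g @: X2) != 1)%N)%:R) <= 2 * eta.
Proof.
have [cS dS] := S_part.
move=> c0 c1 c2 d01 d02 d12 sub.
pose Z := (X0 :|: X1 :|: X2) :\: S0.
have cX : #|X0 :|: X1 :|: X2| = (m + m + m)%N.
  by rewrite !card_disjointU ?c0 ?c1 ?c2 // disjointsU d02 d12.
have cZ : #|S1 :|: S2| = #|Z|.
  rewrite card_disjointU ?cS; last by apply: dS.
  by rewrite /Z cardsDS // cX cS addnK.
(* This [p] fixes the points of [S0] and carries [S1 :|: S2] onto the rest of [X0 :|: X1 :|: X2], so
   both partitions below share their blocks from the fourth on. *)
have [||p pS0 pZ] := perm_on_transitive _ _ cZ (Y := ~: S0).
- by rewrite -disjoints_subset disjointsU !dS.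
- by rewrite /Z setDE subsetIr.
have p0 : p @: S0 = S0 by apply: imset_perm_id.
have pU : p @: (S0 :|: S1 :|: S2) = X0 :|: X1 :|: X2.
  by rewrite -setUA imsetU p0 pZ /Z setDE setUIr setUCr setIT; apply/setUidPr.
have part1 : is_block_partition (three_blocks p S0 (p @: S1) (p @: S2)).
  have inj : injective p by exact: perm_inj.
  apply: three_blocks_part; rewrite ?card_imset ?imset_disjoint ?cS ?dS //.
  - by rewrite -p0 imset_disjoint ?dS.
  - by rewrite -p0 imset_disjoint ?dS.
  - by rewrite !imsetU p0.
have part2 : is_block_partition (three_blocks p X0 X1 X2).
  by apply: three_blocks_part; rewrite ?pU.
have -> : 2 * eta = eta + eta by ring.
apply: le_trans (lerD (exactly_one part1) (exactly_one part2)).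
rewrite -avgD; apply: ler_avg => g; rewrite -natrD ler_nat.
rewrite !(sum_three_blocks _ _ _ _ (fun X => h (g @: X) : nat)).
set r := (\sum_(i < k) _)%N.
case: (h (g @: S0)); case: (h (g @: (p @: S1))); case: (h (g @: (p @: S2)));
case: (h (g @: X0)); case: (h (g @: X1)); case: (h (g @: X2)); case: r => [|r] //.
Qed.

Lemma card_setC_block : #|~: S0| = (k.+2 * m)%N.
Proof.
have := cardsC S0; rewrite card_ord (proj1 S_part) => e.
by apply/eqP; rewrite -(eqn_add2l m) e -mulSn; apply/eqP.
Qed.

Lemma disjoint_block X Y : X \subset S0 -> Y \subset ~: S0 -> [disjoint X & Y].
Proof.
move=> XS; rewrite disjoint_sym disjoints_subset => YS.
by rewrite (subset_trans YS) // setCS.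
Qed.

Lemma disjoint_blockU A1 A2 B1 B2 : A1 \subset S0 -> A2 \subset S0 ->
  B1 \subset ~: S0 -> B2 \subset ~: S0 ->
  [disjoint A1 & A2] -> [disjoint B1 & B2] -> [disjoint A1 :|: B1 & A2 :|: B2].
Proof.
move=> s1 s2 t1 t2 dA dB.
rewrite disjointsU disjoint_sym [X in _ && X]disjoint_sym !disjointsU.
rewrite disjoint_sym dA [X in X && _]disjoint_sym disjoint_block //=.
by rewrite disjoint_block // disjoint_sym.
Qed.

(** Split the same [3 * m] points in two ways, with a common block [X2]: into [S0], [B :|: B'],
    [X2], and into the two completions and [X2]. If [S0] is in [h], the first splitting excludes
    [X2], and the second then has exactly one of the two completions in [h]. *)
Lemma complement_pair A B B' : A \subset S0 -> B \subset ~: S0 -> B' \subset ~: S0 ->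
  [disjoint B & B'] -> #|B| = (m - #|A|)%N -> #|B'| = #|A| ->
  avg (fun g : {perm 'I_n} => (h (g @: S0) &&
    (h (g @: (A :|: B)) + h (g @: (S0 :\: A :|: B')) != 1)%N)%:R) <= 4 * eta.
Proof.
move=> AS BS BS' dB cB cB'; have [cS dS] := S_part.
have Am : (#|A| <= m)%N by rewrite -(cS ord0) subset_leq_card.
have [|X2 X2s cX2] := @subset_of_card _ (~: S0 :\: (B :|: B')) m.
  rewrite cardsDS ?subUset ?BS // card_setC_block card_disjointU // cB cB' subnK //.
  by rewrite mulSn addKn mulSn leq_addr.
have X2S : X2 \subset ~: S0 by rewrite (subset_trans X2s) // subsetDl.
have : [disjoint X2 & B :|: B'] by move: X2s; rewrite subsetD => /andP[].
rewrite disjoint_sym disjointsU => /andP[dB2 dB2'].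
have cBB : #|B :|: B'| = m by rewrite card_disjointU // cB cB' subnK.
have DA : S0 :\: A \subset S0 by exact: subsetDl.
have r1 : avg (fun g : {perm 'I_n} => (h (g @: S0) &&
    (h (g @: S0) + h (g @: (B :|: B')) + h (g @: X2) != 1)%N)%:R) <= 2 * eta.
  apply: resplit; rewrite ?cS //.
  - by apply: disjoint_block; rewrite // subUset BS.
  - exact: disjoint_block.
  - by rewrite disjointsU dB2.
  - by rewrite -setUA subsetUl.
have r2 : avg (fun g : {perm 'I_n} => (h (g @: S0) &&
    (h (g @: (A :|: B)) + h (g @: (S0 :\: A :|: B')) + h (g @: X2) != 1)%N)%:R) <= 2 * eta.
  apply: resplit => //.
  - by rewrite (card_disjointU (disjoint_block AS BS)) cB subnKC.
  - by rewrite (card_disjointU (disjoint_block DA BS')) cB' cardsDS // cS subnK.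
  - apply: disjoint_blockU => //.
    by rewrite -setI_eq0 setDE setICA setICr setI0.
  - by rewrite disjointsU (disjoint_block AS X2S).
  - by rewrite disjointsU (disjoint_block DA X2S).
  - apply/subsetP => x xS; rewrite !inE xS andbT.
    by case: (x \in A); rewrite /= ?orbT.
have -> : 4 * eta = 2 * eta + 2 * eta by ring.
apply: le_trans (lerD r1 r2); rewrite -avgD; apply: ler_avg => g.
rewrite -natrD ler_nat.
case: (h (g @: S0)) => //; case: (h (g @: (B :|: B'))); case: (h (g @: X2));
case: (h (g @: (A :|: B))); by case: (h (g @: (S0 :\: A :|: B'))).
Qed.

(** Both completions of [A] are paired with the same completion of [S0 :\: A] by a set [B'] disjoint
    from [B1] and [B2]. Exactly one member of each pair is in [h], so the two completions agree. *)
Lemma fill_agree A B1 B2 : A \subset S0 -> B1 \subset ~: S0 -> B2 \subset ~: S0 ->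
  #|B1| = (m - #|A|)%N -> #|B2| = (m - #|A|)%N ->
  avg (fun g : {perm 'I_n} => (h (g @: S0))%:R * ((h (g @: (A :|: B1)))%:R *
    (1 - (h (g @: (A :|: B2)))%:R))) <= 8%:R * eta.
Proof.
move=> AS BS1 BS2 c1 c2; have [cS dS] := S_part.
have Am : (#|A| <= m)%N by rewrite -(cS ord0) subset_leq_card.
have [|B' B's cB'] := @subset_of_card _ (~: S0 :\: (B1 :|: B2)) #|A|.
  rewrite cardsDS ?subUset ?BS1 // card_setC_block.
  have [le _] := leq_card_setU B1 B2; rewrite c1 c2 in le; nia.
have BS' : B' \subset ~: S0 by rewrite (subset_trans B's) // subsetDl.
have : [disjoint B' & B1 :|: B2] by move: B's; rewrite subsetD => /andP[].
rewrite disjoint_sym disjointsU => /andP[d1 d2].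
have -> : 8%:R * eta = 4 * eta + 4 * eta by ring.
apply: le_trans (lerD (complement_pair AS BS1 BS' d1 c1 cB')
                      (complement_pair AS BS2 BS' d2 c2 cB')).
rewrite -avgD; apply: ler_avg => g.
case: (h (g @: S0)); case: (h (g @: (A :|: B1))); case: (h (g @: (A :|: B2)));
case: (h (g @: (S0 :\: A :|: B'))) => /=; lra.
Qed.

Let fp := fill_prob R m h.

(** The product [f * (1 - f)] is the probability that, of two independent completions, the first is
    in [h] and the second is not; [fill_agree] bounds it for every pair of completions. *)
Lemma fill_prob_var A : A \subset S0 ->
  avg (fun g : {perm 'I_n} => (h (g @: S0))%:R *
    (fp (g @: S0) (g @: A) * (1 - fp (g @: S0) (g @: A)))) <= 8%:R * eta.
Proof.
move=> AS; have [cS dS] := S_part.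
have Am : (#|A| <= m)%N by rewrite -(cS ord0) subset_leq_card.
have room : (m - #|A| <= #|~: S0|)%N by rewrite card_setC_block; nia.
rewrite (eq_avg (g := fun g : {perm 'I_n} =>
  level_avg (~: S0) (m - #|A|) (fun B1 => level_avg (~: S0) (m - #|A|) (fun B2 =>
   (h (g @: S0))%:R * ((h (g @: (A :|: B1)))%:R * (1 - (h (g @: (A :|: B2)))%:R)))))).
  rewrite avg_level_avg -(level_avg_cst (8%:R * eta) room).
  apply: ler_level_avg => B1 B1S c1; rewrite avg_level_avg -(level_avg_cst (8%:R * eta) room).
  by apply: ler_level_avg => B2 B2S c2; exact: fill_agree.
move=> g; rewrite /fp fill_prob_imset.
set F := level_avg _ _ _.
have F1 : 1 - F = level_avg (~: S0) (m - #|A|) (fun B => 1 - (h (g @: (A :|: B)))%:R).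
  rewrite level_avgD level_avg_cst //; congr (_ + _).
  rewrite -mulN1r -level_avgZ; apply: eq_level_avg => B _ _; by rewrite mulN1r.
rewrite F1; set L := level_avg _ _ _.
rewrite [RHS](eq_level_avg (phi2 := fun B1 => (h (g @: S0))%:R * L *
  (h (g @: (A :|: B1)))%:R)) => [|B1 _ _].
  by rewrite level_avgZ -/F; ring.
rewrite [LHS](eq_level_avg (phi2 := fun B2 => (h (g @: S0))%:R *
  (h (g @: (A :|: B1)))%:R * (1 - (h (g @: (A :|: B2)))%:R))) => [|B2 _ _]; last by ring.
by rewrite level_avgZ -/L; ring.
Qed.

(** The three parts of [S0] are completed by disjoint sets [B0], [B1], [B2], of [2 * m] points in
    all, so [resplit] applies. *)
Lemma fill_prob_split (c : {ffun 'I_n -> 'I_3}) :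
  avg (fun g : {perm 'I_n} => (h (g @: S0))%:R *
    `|\sum_(v < 3) fp (g @: S0) (g @: (S0 :&: colour_class c v)) - 1|) <= 4 * eta.
Proof.
have [cS dS] := S_part.
pose A v := S0 :&: colour_class c v.
have AS v : A v \subset S0 by exact: subsetIl.
have dA v w : v != w -> [disjoint A v & A w].
  move=> vw; rewrite -setI_eq0; apply/eqP/setP => i; rewrite !inE.
  by case: (c i =P v) => [->|]; rewrite ?(negbTE vw) ?andbF.
pose A0 := A 0; pose A1 := A 1; pose A2 := A 2%:R.
have s0 : A0 \subset S0 := AS _; have s1 : A1 \subset S0 := AS _.
have s2 : A2 \subset S0 := AS _.
have dA01 : [disjoint A0 & A1] by exact: dA.
have dA02 : [disjoint A0 & A2] by exact: dA.
have dA12 : [disjoint A1 & A2] by exact: dA.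
have AU : A0 :|: A1 :|: A2 = S0.
  apply/setP => i; rewrite !inE -!andb_orr; case: (i \in S0) => //=.
  by case: (c i) => [[|[|[|]]]].
have cA : (#|A0| + #|A1| + #|A2| = m)%N.
  by rewrite -(cS ord0) -AU !card_disjointU // disjointsU dA02.
have room : (m + m <= k.+2 * m)%N by rewrite !mulSn addnA leq_addr.
have le0 : (#|A0| <= m)%N by rewrite -cA -addnA leq_addr.
have le1 : (#|A1| <= m)%N by rewrite -cA addnAC leq_addl.
have le2 : (#|A2| <= m)%N by rewrite -cA leq_addl.
have [|B0 B0S cB0] := @subset_of_card _ (~: S0) (m - #|A0|).
  by rewrite card_setC_block (leq_trans (leq_subr _ _)) // leq_pmull.
have [|B1 B1s cB1] := @subset_of_card _ (~: S0 :\: B0) (m - #|A1|).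
  rewrite cardsDS // card_setC_block cB0 (leq_trans _ (leq_sub2r _ room)) //.
  exact: leq_sub_pair.
have B1S : B1 \subset ~: S0 by rewrite (subset_trans B1s) // subsetDl.
have d01 : [disjoint B0 & B1] by move: B1s; rewrite subsetD disjoint_sym => /andP[].
have [|B2 B2s cB2] := @subset_of_card _ (~: S0 :\: (B0 :|: B1)) (m - #|A2|).
  rewrite cardsDS ?subUset ?B0S // card_setC_block card_disjointU // cB0 cB1.
  by rewrite (leq_trans _ (leq_sub2r _ room)) // leq_sub_triple.
have B2S : B2 \subset ~: S0 by rewrite (subset_trans B2s) // subsetDl.
have : [disjoint B2 & B0 :|: B1] by move: B2s; rewrite subsetD => /andP[].
rewrite disjoint_sym disjointsU => /andP[d02 d12].
have r : avg (fun g : {perm 'I_n} => (h (g @: S0) &&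
    (h (g @: (A0 :|: B0)) + h (g @: (A1 :|: B1)) + h (g @: (A2 :|: B2)) != 1)%N)%:R)
    <= 2 * eta.
  apply: resplit; try exact: disjoint_blockU.
  - by rewrite (card_disjointU (disjoint_block s0 B0S)) cB0 subnKC ?le0.
  - by rewrite (card_disjointU (disjoint_block s1 B1S)) cB1 subnKC ?le1.
  - by rewrite (card_disjointU (disjoint_block s2 B2S)) cB2 subnKC ?le2.
  - rewrite -{1}AU; apply/subsetP => i; rewrite !inE.
    by move=> /orP[/orP[]|] ->; rewrite ?orbT.
(* The number of completions in [h] lies between 0 and 3, so it differs from 1 by at most 2. *)
have -> : 4 * eta = 2 * (2 * eta) by ring.
apply: (@le_trans _ _ (2 * avg (fun g : {perm 'I_n} => (h (g @: S0) &&
    (h (g @: (A0 :|: B0)) + h (g @: (A1 :|: B1)) + h (g @: (A2 :|: B2)) != 1)%N)%:R)));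
  last by rewrite ler_pM2l.
(* Permuting the points outside [S0] makes each completion uniform. The three completions are
   dependent, but linearity needs only their marginals. *)
rewrite -avgZ -[leRHS](avg_sym_avg (~: S0)).
apply: ler_avg => g.
rewrite !big_ord_recl big_ord0 addr0.
rewrite (_ : lift ord0 ord0 = 1); last exact/val_inj.
rewrite (_ : lift ord0 (lift ord0 ord0) = 2%:R); last exact/val_inj.
rewrite (_ : ord0 = 0) // -/(A 0) -/(A 1) -/(A 2%:R) /fp.
rewrite (fill_prob_sym _ _ _ (AS 0) B0S cB0) (fill_prob_sym _ _ _ (AS 1) B1S cB1).
rewrite (fill_prob_sym _ _ _ (AS 2%:R) B2S cB2).
rewrite -!sym_avgD -[X in `|_ + X|](sym_avg_cst (~: S0)) -sym_avgD.
apply: le_trans (ler_wpM2l (ler0n _ _) (ler_norm_sym_avg _ _)) _.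
rewrite -sym_avgZ /sym_avg ler_wpM2r ?invr_ge0 ?ler0n //; apply: ler_sum => p pS.
have -> : (p * g)%g @: S0 = g @: S0.
  rewrite -{2}(imset_perm_id pS) -imset_comp; apply: eq_imset => x.
  by rewrite /= permM.
set x0 := h (_ @: (A0 :|: B0)); set x1 := h (_ @: (A1 :|: B1)).
set x2 := h (_ @: (A2 :|: B2)).
case: (h (g @: S0)); last by rewrite mul0r mulr0.
case: x0; case: x1; case: x2; rewrite mul1r /= ?mulr1 ?mulr0 ?addr0 ?add0r ?subrr ?normr0 //;
  rewrite ler_norml; lra.
Qed.

Lemma avg_relabel (g : {perm 'I_n}) (f : ('I_3 -> {set 'I_n}) -> R) :
  (forall X Y : 'I_3 -> {set 'I_n}, X =1 Y -> f X = f Y) ->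
  avg (fun c : {ffun 'I_n -> 'I_3} => f (colour_class c)) =
  avg (fun c : {ffun 'I_n -> 'I_3} => f (fun v => g @: colour_class c v)).
Proof.
move=> fE; pose rl (c : {ffun 'I_n -> 'I_3}) : {ffun 'I_n -> 'I_3} := [ffun i => c ((g^-1)%g i)].
have rlI : injective rl.
  by move=> c c' /ffunP e; apply/ffunP => i; have := e (g i); rewrite !ffunE permK.
rewrite (reindex_avg _ rlI); apply: eq_avg => c; apply: fE => v.
apply/setP => i; rewrite -[i](permKV g) mem_imset ?inE ?ffunE ?permK //.
exact: perm_inj.
Qed.

(** The image of [S0] under a random permutation is a uniform [m]-set, and relabelling the points
    keeps the colouring uniform. *)
Lemma level_split :
  level_avg setT m (fun U => (h U)%:R * avg (fun c : {ffun 'I_n -> 'I_3} =>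
    `|\sum_(v < 3) fp U (U :&: colour_class c v) - 1|)) <= 4 * eta.
Proof.
have [cS dS] := S_part.
rewrite -{1}(cS ord0) -avg_imset.
rewrite (eq_avg (g := fun g : {perm 'I_n} => avg (fun c : {ffun 'I_n -> 'I_3} =>
  (h (g @: S0))%:R * `|\sum_(v < 3) fp (g @: S0) (g @: (S0 :&: colour_class c v)) - 1|))).
  rewrite exchange_avg -(avg_cst ([ffun=> ord0] : {ffun 'I_n -> 'I_3}) (4 * eta)).
  by apply: ler_avg => c; exact: fill_prob_split.
move=> g; rewrite -avgZ.
rewrite (avg_relabel g (f := fun Z => (h (g @: S0))%:R *
   `|\sum_(v < 3) fp (g @: S0) (g @: S0 :&: Z v) - 1|)); last first.
  by move=> Z Z' ZZ'; congr (_ * `|_ - _|); apply: eq_bigr => v _; rewrite ZZ'.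
apply: eq_avg => c; congr (_ * `|_ - _|); apply: eq_bigr => v _.
by rewrite -imsetI // => ? ? _ _; exact: perm_inj.
Qed.

Lemma level_var :
  level_avg setT m (fun U => (h U)%:R * avg (fun c : {ffun 'I_n -> 'I_3} =>
    fp U (U :&: colour_class c 0) * (1 - fp U (U :&: colour_class c 0)))) <= 8%:R * eta.
Proof.
have [cS dS] := S_part.
rewrite -{1}(cS ord0) -avg_imset.
rewrite (eq_avg (g := fun g : {perm 'I_n} => avg (fun c : {ffun 'I_n -> 'I_3} =>
  (h (g @: S0))%:R * (fp (g @: S0) (g @: (S0 :&: colour_class c 0)) *
     (1 - fp (g @: S0) (g @: (S0 :&: colour_class c 0))))))).
  rewrite exchange_avg -(avg_cst ([ffun=> ord0] : {ffun 'I_n -> 'I_3}) (8%:R * eta)).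
  by apply: ler_avg => c; apply: fill_prob_var; exact: subsetIl.
move=> g; rewrite -avgZ.
rewrite (avg_relabel g (f := fun Z => (h (g @: S0))%:R *
   (fp (g @: S0) (g @: S0 :&: Z 0) * (1 - fp (g @: S0) (g @: S0 :&: Z 0))))); last first.
  by move=> Z Z' ZZ'; rewrite ZZ'.
by apply: eq_avg => c; rewrite -imsetI // => ? ? _ _; exact: perm_inj.
Qed.

End ExactlyOne.

(** * Existence and uniqueness of pivots *)

Section Pivot.
Variables (R : realFieldType) (n m : nat) (h : pred {set 'I_n}).
Hypothesis n3m : (3 * m <= n)%N.
Implicit Types U A B K : {set 'I_n}.
Local Notation C := {ffun 'I_n -> 'I_3}.
Let fp := fill_prob R m h.

Definition pivot (eps : R) U (x : 'I_n) : bool :=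
  (x \in U) && (avg (fun c : C =>
    `|fp U (U :&: colour_class c 0) - (c x == 0)%:R|) <= eps).

Lemma fill_prob_card_le1 U A : #|U| = m -> fp U A <= 1.
Proof.
by move=> Um; apply: fill_prob_le1; have := cardsC U; rewrite card_ord Um; lia.
Qed.

(** Round the completion probability [f] at 1/2 to a Boolean [Phi]. The rounding error is at most
    [2 * f * (1 - f)] per colour class, which over three classes gives the coefficient 6. The
    dictator of [Phi] lies in [U], since [Phi] ignores the colours outside [U]. Of the final
    [3 * eps], one [eps] pays for rounding and two for [dictator]. *)
Lemma pivot_exists (eps eta : R) U : #|U| = m -> 0 < eps -> eps <= 1 / 20%:R ->
  12%:R * eta <= eps ^+ 2 ->
  avg (fun c : C => `|\sum_(v < 3) fp U (U :&: colour_class c v) - 1|) +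
    6%:R * avg (fun c : C => fp U (U :&: colour_class c 0) *
      (1 - fp U (U :&: colour_class c 0))) <= eta ->
  exists x, pivot (3 * eps) U x.
Proof.
move=> Um eps0 eps20 etaeps; set d1 := avg _; set d2 := avg _ => dd.
pose Phi X := (1 / 2 : R) <= fp U (U :&: X).
have f01 X : 0 <= fp U X <= 1 by rewrite fill_prob_ge0 fill_prob_card_le1.
have round X : `|(Phi X)%:R - fp U (U :&: X)| <= 2 * (fp U (U :&: X) * (1 - fp U (U :&: X))).
  have /andP[] := f01 (U :&: X); rewrite /Phi; set f := fp _ _ => f0 f1.
  have [hf|hf] := leP (1 / 2) f => /=.
    by rewrite ger0_norm ?subr_ge0 //; nra.
  by rewrite sub0r normrN ger0_norm //; nra.
have one : avg (fun c : C => (~~ one_class Phi c)%:R) <= eta.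
  apply: le_trans dd; rewrite /d1.
  have -> : 6%:R * d2 = \sum_(v < 3) avg (fun c : C =>
      2 * (fp U (U :&: colour_class c v) * (1 - fp U (U :&: colour_class c v)))).
    rewrite (eq_bigr (fun=> 2 * d2)) => [|v _].
      by rewrite sumr_const card_ord -mulr_natl; ring.
    rewrite avgZ; congr (_ * _).
    exact: (avg_colour_class (fun X => fp U (U :&: X) * (1 - fp U (U :&: X)))).
  rewrite -avg_sum -avgD; apply: ler_avg => c.
  apply: (@le_trans _ _ `|\sum_(v < 3) (Phi (colour_class c v))%:R - 1|).
    rewrite /one_class !big_ord_recl !big_ord0.
    case: (Phi _); case: (Phi _); case: (Phi _) => //=;
      rewrite ?addr0 ?add0r ?subrr ?normr0 //=; rewrite ler_normr; lra.
  have -> : \sum_(v < 3) (Phi (colour_class c v))%:R - 1 =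
     (\sum_(v < 3) fp U (U :&: colour_class c v) - 1) +
     \sum_(v < 3) ((Phi (colour_class c v))%:R - fp U (U :&: colour_class c v)).
    by rewrite sumrB; ring.
  apply: le_trans (ler_normD _ _) _; rewrite lerD2l.
  by apply: le_trans (ler_norm_sum _ _ _) _; apply: ler_sum => v _.
have [j [jle [c [c' [cc' Pcc']]]]] := dictator one eps0 eps20 etaeps.
exists j; apply/andP; split.
  apply: contraNT Pcc' => jU; rewrite /Phi.
  suff -> : U :&: colour_class c 0 = U :&: colour_class c' 0 by [].
  apply/setP => i; rewrite !inE; case: (boolP (i \in U)) => //= iU.
  by rewrite cc' //; apply: contraNneq jU => <-.
have d20 : 0 <= d1 by apply: avg_ge0.
have d2e : 2 * d2 <= eps by rewrite expr2 in etaeps; nra.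
have -> : 3 * eps = eps + 2 * eps by ring.
apply: le_trans (lerD d2e jle); rewrite /d2 -avgZ -avgD; apply: ler_avg => c1.
have /= := round (colour_class c1 0); set f := fp _ _; set b := Phi _.
rewrite ler_norml => /andP[r1 r2].
by rewrite ler_norml; case: (b) r1 r2; case: (c1 j == 0) => /= r1 r2; lra.
Qed.

Lemma avg_coord_indep (j : 'I_n) (a : 'I_3 -> R) (psi : C -> R) :
  (forall c c' : C, (forall i, i != j -> c i = c' i) -> psi c = psi c') ->
  avg (fun c : C => a (c j) * psi c) = avg a * avg psi.
Proof.
move=> psij; rewrite -[LHS](avg_mix [set j]) -(avg_coord j a) -avgM2.
apply: eq_avg => x; apply: eq_avg => y; rewrite ffunE inE eqxx; congr (_ * _).
by apply: psij => i ij; rewrite ffunE inE (negbTE ij).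
Qed.

(** Consider the sets [K :|: (x' |: B)] with [B] outside [A], [x] and [x']. They are the completions
    of [K] off [x |: A] that contain [x'], a proportion [(m - #|K|) / (n - m)], and also the
    completions of [x' |: K] off [x' |: A] that avoid [x]. Those in [h], counted by [Q], contribute
    to the first term, the others to the second. *)
Lemma fill_prob_exchange A K x x' : x != x' -> x \notin A -> x' \notin A ->
  #|A|.+1 = m -> K \subset A ->
  (m - #|K|)%:R / (n - m)%:R <= fp (x |: A) K + (1 - fp (x' |: A) (x' |: K)).
Proof.
move=> xx' xA x'A cA KA.
have Km : (#|K| < m)%N by rewrite -cA ltnS subset_leq_card.
pose j := (m - #|K|.+1)%N; have jE : (m - #|K|)%N = j.+1 by rewrite /j; lia.
pose Y := ~: (x |: (x' |: A)).
pose N := (n - m)%N; have NE : N = N.-1.+1 by rewrite /N; lia.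
have cU : #|x |: A| = m by rewrite cardsU1 xA.
have cU' : #|x' |: A| = m by rewrite cardsU1 x'A.
have cCU : #|~: (x |: A)| = N by have := cardsC (x |: A); rewrite card_ord cU /N; lia.
have cCU' : #|~: (x' |: A)| = N by have := cardsC (x' |: A); rewrite card_ord cU' /N; lia.
have cY : #|Y| = N.-1.
  have := cardsC (x |: (x' |: A)); rewrite card_ord cardsU1 cU' !inE negb_or xx' xA /Y /N.
  by lia.
have cK' : #|x' |: K| = #|K|.+1.
  by rewrite cardsU1 (contraNN (subsetP KA x') x'A).
have bin1 : 'C(N, j)%:R <= 'C(N, j.+1)%:R :> R.
  rewrite ler_nat -(leq_pmul2l (ltn0Sn j)) mul_bin_left mulnC [X in (_ <= X)%N]mulnC.
  by rewrite leq_mul2l; apply/orP; right; rewrite /j /N; lia.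
have C1 : 0 < 'C(N, j.+1)%:R :> R by rewrite ltr0n bin_gt0 /N /j; lia.
have C0 : 0 < 'C(N, j)%:R :> R by rewrite ltr0n bin_gt0 /N /j; lia.
pose Q := \sum_(B : {set 'I_n} | (B \subset Y) && (#|B| == j)) (h (K :|: (x' |: B)))%:R : R.
have Q1 : Q / 'C(N, j.+1)%:R <= fp (x |: A) K.
  rewrite /fp /fill_prob /level_avg cCU jE ler_wpM2r ?invr_ge0 ?ler0n //.
  rewrite [leRHS](bigID (fun B : {set 'I_n} => x' \in B)) /= -[leLHS]addr0.
  apply: lerD; last by apply: sumr_ge0 => B _; exact: ler0n.
  rewrite (reindex_onto (fun B => x' |: B) (fun B => B :\ x')) /=; last first.
    by move=> B /andP[_ x'B]; rewrite setD1K.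
  rewrite le_eqVlt; apply/orP; left; apply/eqP; apply: eq_bigl => B.
  rewrite setU11 andbT; apply/idP/idP.
    move=> /andP[BY /eqP Bj].
    have x'B : x' \notin B by apply: contraTN BY => x'B; apply/subsetPn; exists x' => //; rewrite !inE eqxx orbT.
    rewrite setU1K // eqxx andbT cardsU1 x'B Bj eqxx andbT subUset sub1set !inE negb_or.
    rewrite eq_sym xx' x'A /= (subset_trans BY) // setCS.
    by rewrite setUCA subsetUr.
  move=> /andP[/andP[]]; rewrite subUset => /andP[_ BU] /eqP cB /eqP BE.
  have x'B : x' \notin B by rewrite -BE !inE eqxx.
  move: cB; rewrite cardsU1 x'B /= add1n => /eq_add_S ->; rewrite eqxx andbT /Y.
  apply/subsetP => i iB; have := subsetP BU i iB; rewrite !inE !negb_or => /andP[-> ->].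
  by rewrite andbT /=; apply: contraNneq x'B => <-.
have Q2 : ('C(N.-1, j)%:R - Q) / 'C(N, j)%:R <= 1 - fp (x' |: A) (x' |: K).
  have -> : 1 - fp (x' |: A) (x' |: K) =
     (\sum_(B : {set 'I_n} | (B \subset ~: (x' |: A)) && (#|B| == j))
        (1 - (h (x' |: K :|: B))%:R)) / 'C(N, j)%:R.
    rewrite /fp /fill_prob /level_avg cCU' cK' -/j sumrB mulrBl; congr (_ - _).
    rewrite sumr_const -{1}cCU' -cards_draws cardsE divff // -cardsE cards_draws cCU'.
    by rewrite gt_eqF.
  rewrite ler_wpM2r ?invr_ge0 ?ler0n //.
  have -> : 'C(N.-1, j)%:R - Q = \sum_(B : {set 'I_n} | (B \subset Y) && (#|B| == j))
      (1 - (h (K :|: (x' |: B)))%:R).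
    by rewrite sumrB sumr_const -cY -cards_draws cardsE.
  rewrite [leRHS](bigID (fun B : {set 'I_n} => x \notin B)) /= -[leLHS]addr0.
  apply: lerD; last by apply: sumr_ge0 => B _; case: (h _); rewrite ?subr0 ?subrr.
  rewrite le_eqVlt; apply/orP; left; apply/eqP; apply: eq_big => B.
    rewrite /Y [RHS]andbAC; congr (_ && _).
    by rewrite setCU subsetI andbC [X in _ && X]subsetC sub1set inE.
  by move=> _; rewrite setUA [K :|: _]setUC.
apply: le_trans (lerD Q1 Q2).
apply: (@le_trans _ _ (Q / 'C(N, j.+1)%:R + ('C(N.-1, j)%:R - Q) / 'C(N, j.+1)%:R)).
  rewrite -mulrDl subrKC -/N jE.
  have N0 : (N%:R : R) != 0 by rewrite NE pnatr_eq0.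
  rewrite le_eqVlt; apply/orP; left; rewrite eqr_div //; last by rewrite gt_eqF.
  by rewrite -!natrM -mul_bin_diag mulnC.
rewrite lerD2l ler_wpM2l ?lef_pV2 ?posrE // subr_ge0 -cY -cards_draws -cardsE.
rewrite -sum1_card natr_sum /Q big_mkcond /= [leRHS]big_mkcond /=.
apply: ler_sum => B _; rewrite !inE; case: ifP => // _.
by rewrite -[1]/(1%:R) ler_nat leq_b1.
Qed.

(** Suppose the pivots differ, and let [K] be the part of [A] of colour 0. With probability 2/3 the
    point [x] has another colour, so completions of [K] are rarely in [h]. With probability 1/3 the
    point [x'] has colour 0, so completions of [x' |: K] are mostly in [h]. The two means thus add
    up to at most [9 / 2 * eps], against the exchange bound. *)
Lemma pivot_unique (eps : R) A x x' : x \notin A -> x' \notin A -> #|A|.+1 = m ->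
  27%:R * eps * (n - m)%:R < 4 * m%:R ->
  pivot eps (x |: A) x -> pivot eps (x' |: A) x' -> x = x'.
Proof.
move=> xA x'A cA small /andP[_ px] /andP[_ px']; apply/eqP; apply: contraTT small => xx'.
rewrite -leNgt.
pose K (c : C) := A :&: colour_class c 0.
have Kj (j : 'I_n) (c c' : C) : j \notin A -> (forall i, i != j -> c i = c' i) -> K c = K c'.
  move=> jA cc'; apply/setP => i; rewrite !inE; case: (boolP (i \in A)) => //= iA.
  by rewrite cc' //; apply: contraNneq jA => <-.
have cU : #|x |: A| = m by rewrite cardsU1 xA.
have cU' : #|x' |: A| = m by rewrite cardsU1 x'A.
have e1 : (2 / 3) * avg (fun c => fp (x |: A) (K c)) <= eps.
  apply: le_trans px.
  have <- : avg (fun v : 'I_3 => (v != 0)%:R) = 2 / 3 :> R.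
    by rewrite /avg card_ord !big_ord_recl big_ord0 /= ?addr0 ?add0r.
  rewrite -(avg_coord_indep (j := x)); last by move=> c c' cc'; rewrite (Kj x c c').
  apply: ler_avg => c; have [cx|cx] := eqVneq (c x) 0; first by rewrite mul0r.
  rewrite mul1r subr0 (_ : (_ |: _) :&: _ = K c) ?ler_norm //.
  apply/setP => i; rewrite !inE; case: eqP => //= ->.
  by rewrite (negbTE cx) andbF.
have e2 : (1 / 3) * avg (fun c => 1 - fp (x' |: A) (x' |: K c)) <= eps.
  apply: le_trans px'.
  have <- : avg (fun v : 'I_3 => (v == 0)%:R) = 1 / 3 :> R.
    by rewrite /avg card_ord !big_ord_recl big_ord0 /= ?addr0 ?add0r.
  rewrite -(avg_coord_indep (j := x')); last by move=> c c' cc'; rewrite (Kj x' c c').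
  apply: ler_avg => c; have [cx|cx] := eqVneq (c x') 0; last by rewrite mul0r.
  rewrite mul1r distrC (_ : (_ |: _) :&: _ = x' |: K c) ?ler_norm //.
  apply/setP => i; rewrite !inE; case: eqP => //= ->.
  by rewrite cx.
have m0 : (0 < m)%N by rewrite -cA.
have N0 : 0 < (n - m)%:R :> R by rewrite ltr0n; lia.
(* On average [K] has [(m - 1) / 3] points. *)
have e3 : (2 / 3) * m%:R / (n - m)%:R <=
    avg (fun c => fp (x |: A) (K c)) + avg (fun c => 1 - fp (x' |: A) (x' |: K c)).
  apply: (@le_trans _ _ (avg (fun c => (m - #|K c|)%:R / (n - m)%:R))); last first.
    rewrite -avgD; apply: ler_avg => c; apply: fill_prob_exchange => //.
    exact: subsetIl.
  rewrite avgZr ler_wpM2r ?invr_ge0 ?ler0n //.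
  have Kle c : (#|K c| <= m)%N.
    by rewrite -cA ltnW // ltnS subset_leq_card // subsetIl.
  rewrite (eq_avg (g := fun c : C => m%:R - \sum_(i in A) (c i == 0)%:R)); last first.
    move=> c; rewrite natrB //; congr (_ - _).
    rewrite -sum1_card natr_sum /= [RHS]big_mkcond [LHS]big_mkcond /=.
    apply: eq_bigr => i _; rewrite !inE; case: (i \in A) => //=.
    by case: (c i == 0).
  rewrite avgB (avg_cst ([ffun=> ord0] : C)) avg_sum.
  rewrite (eq_bigr (fun=> 1 / 3)) => [|i _]; last first.
    rewrite (avg_coord i (fun v => (v == 0)%:R)).
    by rewrite /avg card_ord !big_ord_recl big_ord0 /= ?addr0 ?add0r.
  rewrite sumr_const -mulr_natr -cA -natr1; lra.
move: e3; rewrite ler_pdivrMr // => e3.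
nra.
Qed.

End Pivot.

(** * A gap in the missing densities of levels m-1 and m *)

Section LevelGap.
Variable R : realFieldType.

Definition level_density n (M : pred {set 'I_n}) (k : nat) : R :=
  level_avg setT k (fun A => (M A)%:R).

Lemma level_densityE n (M : pred {set 'I_n}) k :
  level_density M k = #|[set A : {set 'I_n} | (#|A| == k) && M A]|%:R / 'C(n, k)%:R.
Proof.
rewrite /level_density /level_avg cardsT card_ord; congr (_ / _).
rewrite -sum1_card natr_sum big_mkcond [RHS]big_mkcond; apply: eq_bigr => A _.
by rewrite inE subsetT /=; case: (_ == k); case: (M A).
Qed.

Lemma block_partition_exists m k : exists S : 'I_k.+3 -> {set 'I_(k.+3 * m)},
  is_block_partition m S.
Proof.
have e : #|{: 'I_k.+3 * 'I_m}| = (k.+3 * m)%N by rewrite card_prod !card_ord.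
pose f p := cast_ord e (enum_rank p).
have fI : injective f by move=> p q /cast_ord_inj /enum_rank_inj.
exists (fun i => [set f (i, j) | j : 'I_m]); split=> [i|i i' ii'].
  by rewrite card_imset ?card_ord // => j j' /fI [].
rewrite -setI_eq0; apply/eqP/setP => x; rewrite !inE; apply/negP => /andP[].
move=> /imsetP[j _ ->] /imsetP[j' _ /fI [ij _]].
by rewrite ij eqxx in ii'.
Qed.

Lemma double_block_le m k : (m * 2 <= k.+3 * m - m.-1)%N.
Proof. case: m => [|m] /=; nia. Qed.

(** Removing pivots would embed nearly all of [h], of density about [1 / s] at level [m], into the
    missing sets one level lower. The binomial coefficient at least halves there, so the density
    would be about [2 / s]. The value of [eps] meets the smallness condition of [pivot_unique] for
    [3 * eps], and the constant [90 * 80] makes the members of [h] without pivot negligible. *)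
Lemma level_gap_small n m k (M : pred {set 'I_n}) (eps : R) :
  n = (k.+3 * m)%N -> (0 < m)%N ->
  (forall P : 'I_k.+3 -> {set 'I_n}, is_block_partition m P ->
    exists i, M (P i) || [forall x in P i, M (P i :\ x)]) ->
  eps = (27%:R * k.+2%:R)^-1 ->
  level_density M m.-1 < k.+3%:R^-1 + eps ^+ 2 / ((90%:R * 80%:R) * k.+3%:R ^+ 2) ->
  level_density M m < eps ^+ 2 / ((90%:R * 80%:R) * k.+3%:R ^+ 2) -> False.
Proof.
move=> nE m0 freeM epsE pl ql.
pose h (U : {set 'I_n}) := [forall x in U, M (U :\ x)].
set p := level_density M m.-1 in pl; set q := level_density M m in ql.
pose s : R := k.+3%:R; pose eta := s * p - 1 + 2 * s * q.
have smul (x : R) : x *+ k.+3 = s * x by rewrite /s mulr_natl.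
have dens_perm (N : pred {set 'I_n}) (B : {set 'I_n}) :
    avg (fun g : {perm 'I_n} => (N (g @: B))%:R) = level_density N #|B|.
  exact: (avg_imset B (fun A => (N A)%:R)).
have [S0 S0part] : exists S : 'I_k.+3 -> {set 'I_n}, is_block_partition m S.
  by rewrite nE; exact: block_partition_exists.
(* A random facet of a random [m]-set is uniform on its level, and [h] requires every facet to be
   missing. *)
have hp : level_density h m <= p.
  have [cS _] := S0part; have : (0 < #|S0 ord0|)%N by rewrite cS.
  move=> /card_gt0P[x xS]; rewrite -(cS ord0) -dens_perm /p.
  rewrite (_ : m.-1 = #|S0 ord0 :\ x|); last by rewrite -(cS ord0) (cardsD1 x) xS.
  rewrite -dens_perm; apply: ler_avg => g; rewrite ler_nat.
  case: (boolP (h _)) => //= /forall_inP/(_ (g x)).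
  have -> : g @: S0 ord0 :\ g x = g @: (S0 ord0 :\ x).
    apply/setP => y; rewrite -[y](permKV g) !inE !mem_imset ?inE ?(inj_eq (@perm_inj _ g)) //;
    exact: perm_inj.
  by move=> -> //; rewrite imset_f.
have blockI (P : 'I_k.+3 -> {set 'I_n}) (g : {perm 'I_n}) : is_block_partition m P ->
    @is_block_partition n m k (fun i => g @: P i).
  move=> [cP dP]; split=> [i|i j ij]; first by rewrite card_imset ?cP //; exact: perm_inj.
  by rewrite imset_disjoint ?dP //; exact: perm_inj.
have one (P : 'I_k.+3 -> {set 'I_n}) : is_block_partition m P ->
    avg (fun g : {perm 'I_n} => (\sum_i h (g @: P i) != 1)%N%:R) <= eta.
  move=> Ppart; have [cP _] := Ppart.
  (* With [a] blocks in [h] and [b] blocks in [M], [1 <= a + b] bounds the indicator of [a != 1] by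
     [a - 1 + 2 * b]. *)
  apply: (@le_trans _ _ (avg (fun g : {perm 'I_n} => \sum_i (h (g @: P i))%:R - 1 +
    2 * \sum_i (M (g @: P i))%:R))).
    apply: ler_avg => g; rewrite -!natr_sum.
    have [i] := freeM _ (blockI P g Ppart); rewrite -/(h _) => /orP Mh.
    set a := (\sum_i _)%N; set b := (\sum_(i < k.+3) M _)%N.
    have ab : (1 <= a + b)%N.
      rewrite /a /b (bigD1 i) //= [X in (_ + X)%N](bigD1 i) //=.
      by case: Mh => ->; rewrite /= ?add1n ?addnS.
    have [->|a1] := eqVneq a 1%N => /=.
      by rewrite subrr add0r mulr_ge0.
    have : (2 <= a + 2 * b)%N by clearbody a b; clear -ab a1; lia.
    by rewrite -(ler_nat R) natrD natrM; lra.
  rewrite avgD avgB avgZ (avg_cst (1%g : {perm 'I_n})) !avg_sum.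
  under eq_bigr => i _ do rewrite dens_perm cP.
  under [X in _ + 2 * X]eq_bigr => i _ do rewrite dens_perm cP.
  rewrite !sumr_const card_ord !smul -/q /eta.
  have s0 : 0 <= s by exact: ler0n.
  have := ler_wpM2l s0 hp; lra.
have hlow : 1 - eta <= s * level_density h m.
  have [cS _] := S0part.
  apply: (@le_trans _ _ (avg (fun g : {perm 'I_n} => \sum_i (h (g @: S0 i))%:R))).
    apply: le_trans (lerB (lexx 1) (one _ S0part)) _.
    rewrite -{1}(avg_cst (1%g : {perm 'I_n}) 1) -avgB; apply: ler_avg => g.
    rewrite -natr_sum; set a := (\sum_i _)%N.
    by case: a => [|[|a]]; rewrite /= ?subrr ?subr0 // ler1n.
  rewrite avg_sum; under eq_bigr => i _ do rewrite dens_perm cS.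
  by rewrite sumr_const card_ord smul.
have k2 : 0 < k.+2%:R :> R by rewrite ltr0n.
have k2' : 2 <= k.+2%:R :> R by rewrite ler_nat.
have eps0 : 0 < eps by rewrite epsE invr_gt0; apply: mulr_gt0.
have epsk : eps * (27%:R * k.+2%:R) = 1.
  by rewrite epsE mulVf // gt_eqF //; apply: mulr_gt0.
have eps20 : eps <= 1 / 20%:R by nra.
pose eta1 := eps ^+ 2 / 12%:R.
have eta1P : 12%:R * eta1 <= eps ^+ 2 by rewrite /eta1; lra.
have n3m : (3 * m <= n)%N by rewrite nE leq_mul2r orbT.
pose e := 3 * eps.
pose d1 (U : {set 'I_n}) : R := avg (fun c : {ffun 'I_n -> 'I_3} =>
    `|\sum_(v < 3) fill_prob R m h U (U :&: colour_class c v) - 1|).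
pose d2 (U : {set 'I_n}) : R := avg (fun c : {ffun 'I_n -> 'I_3} =>
    fill_prob R m h U (U :&: colour_class c 0) *
    (1 - fill_prob R m h U (U :&: colour_class c 0))).
pose G := [set U : {set 'I_n} | (#|U| == m) && (h U && [exists x, pivot m h e U x])].
have mle : (m <= #|[set: 'I_n]|)%N by rewrite cardsT card_ord nE leq_pmull.
have mn : (m.-1 <= n)%N.
  by apply: leq_trans (leq_pred _) _; rewrite nE leq_pmull.
(* Markov's inequality: a member of [h] without pivot has [d1 + 6 * d2 > eta1], while the mean is at
   most [(4 + 6 * 8) * eta]. *)
have Glow : level_density h m <= #|G|%:R / 'C(n, m)%:R + 52%:R * eta / eta1.
  have -> : #|G|%:R / 'C(n, m)%:R =
      level_density (fun U => h U && [exists x, pivot m h e U x]) m.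
    by rewrite level_densityE.
  apply: (@le_trans _ _ (level_avg setT m (fun U =>
     (h U && [exists x, pivot m h e U x])%:R +
     eta1^-1 * ((h U)%:R * d1 U + 6%:R * ((h U)%:R * d2 U))))).
    apply: ler_level_avg => U _ cU.
    case: (boolP (h U)) => hU /=; last by rewrite !mul0r mulr0 addr0 mulr0 addr0.
    have eta10 : 0 < eta1 by rewrite /eta1 divr_gt0 ?exprn_gt0.
    have dpos : 0 <= d1 U + 6%:R * d2 U.
      apply: addr_ge0; first exact: avg_ge0.
      apply: mulr_ge0 => //; apply: avg_ge0 => c.
      by apply: mulr_ge0; rewrite ?subr_ge0 ?fill_prob_ge0 //; exact: fill_prob_card_le1.
    have [/existsP ex|noex] := boolP [exists x, pivot m h e U x] => /=.
      by rewrite lerDl !mul1r mulr_ge0 // invr_ge0 ltW.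
    rewrite add0r !mul1r mulrC ler_pdivlMr // mul1r leNgt; apply: contra noex => dlt.
    by apply/existsP; apply: (pivot_exists n3m cU eps0 eps20 eta1P (ltW dlt)).
  rewrite level_avgD lerD2l level_avgZ mulrC ler_wpM2r //.
    by rewrite invr_ge0 /eta1 divr_ge0 ?sqr_ge0.
  rewrite level_avgD level_avgZ.
  have l1 := level_split nE one S0part; have l2 := level_var nE one S0part.
  rewrite -/(d1 _) -/(d2 _) in l1 l2; lra.
have Gup : #|G|%:R <= p * 'C(n, m.-1)%:R.
  rewrite /p level_densityE divfK; last first.
    by rewrite pnatr_eq0 -lt0n bin_gt0.
  rewrite ler_nat.
  pose r (U : {set 'I_n}) := if [pick x | pivot m h e U x] is Some x then U :\ x else U.
  have rP U : U \in G -> exists x, [/\ pivot m h e U x, r U = U :\ x, h U & #|U| = m].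
    rewrite inE => /and3P[/eqP cU hU /existsP[y py]]; rewrite /r.
    by case: pickP => [x px|/(_ y)]; [exists x|rewrite py].
  (* Members with the same remainder have the same pivot by [pivot_unique], hence coincide. *)
  have rI : {in G &, injective r}.
    move=> U U' /rP[x [px -> hU cU]] /rP[x' [px' -> hU' cU']] eqr.
    have xU : x \in U by case/andP: px.
    have xU' : x' \in U' by case/andP: px'.
    have UE : U = x |: (U :\ x) by rewrite setD1K.
    have UE' : U' = x' |: (U :\ x) by rewrite eqr setD1K.
    have xx' : x = x'.
      apply: (pivot_unique n3m (A := U :\ x) (eps := e)).
      - by rewrite !inE eqxx.
      - by rewrite eqr !inE eqxx.
      - by rewrite -cU [in RHS](cardsD1 x) xU.
      - have -> : (n - m)%:R = k.+2%:R * m%:R :> R.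
          by rewrite -natrM nE mulSn addKn.
        have m1 : 0 < m%:R :> R by rewrite ltr0n.
        rewrite /e (_ : 27%:R * (3 * eps) * (k.+2%:R * m%:R) =
                        3 * (eps * (27%:R * k.+2%:R)) * m%:R); last by ring.
        by rewrite epsk; lra.
      - by rewrite -UE; exact: px.
      - by rewrite -UE'; exact: px'.
    by rewrite UE UE' xx'.
  rewrite -(card_in_imset rI); apply: subset_leq_card; apply/subsetP => A.
  move=> /imsetP[U /rP[x [px -> /forall_inP hU cU]] ->]; have xU : x \in U by case/andP: px.
  by rewrite inE hU // andbT; move: cU; rewrite (cardsD1 x) xU => <-.
have Cpos : 0 < 'C(n, m.-1)%:R :> R by rewrite ltr0n bin_gt0.
have C2 : 2 * 'C(n, m.-1)%:R <= 'C(n, m)%:R :> R.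
  rewrite -natrM ler_nat -(leq_pmul2l m0).
  have := mul_bin_left n m.-1; rewrite (prednK m0) => ->.
  by rewrite mulnA leq_mul2r nE double_block_le orbT.
have Cm : 0 < 'C(n, m)%:R :> R by lra.
have s3 : 3 <= s by rewrite ler_nat.
set delta := eps ^+ 2 / _ in pl ql.
have dE : delta * ((90%:R * 80%:R) * s ^+ 2) = eps ^+ 2.
  by rewrite /delta divfK // !mulf_neq0 ?expf_neq0 ?pnatr_eq0.
set sV := k.+3%:R^-1 in pl; have sVE : s * sV = 1 by rewrite divff // pnatr_eq0.
have etal : eta < 3 * s * delta.
  have s0 : 0 < s by lra.
  have a1 : s * p < s * (sV + delta) by rewrite ltr_pM2l.
  have a2 : s * q < s * delta by rewrite ltr_pM2l.
  by rewrite mulrDr sVE in a1; rewrite /eta; lra.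
have eta1E : 600%:R * s * (s * delta) = eta1 by rewrite /eta1 -dE; field.
have eta10 : 0 < eta1 by rewrite /eta1 divr_gt0 ?exprn_gt0.
pose z := eta / eta1.
have zE : z * eta1 = eta by rewrite /z divfK ?gt_eqF.
have zl : 200%:R * s * z <= 1.
  by rewrite /z mulrA ler_pdivrMr // mul1r -eta1E; nra.
have etal1 : eta <= 1 / 100%:R.
  have : eta1 <= 1 / 12%:R by rewrite /eta1; nra.
  nra.
rewrite -mulrA -/z in Glow.
have Gl : (level_density h m - 52%:R * z) * 'C(n, m)%:R <= #|G|%:R.
  by rewrite -ler_pdivlMr //; lra.
have hz : 7 / 10%:R <= s * (level_density h m - 52%:R * z) by lra.
have y0 : 0 <= level_density h m - 52%:R * z by nra.
(* After multiplication by [s] this gives [7 / 5 <= s * p], whereas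
   [s * p < 1 + s * delta <= 4 / 3]. *)
have : 2 * (level_density h m - 52%:R * z) <= p.
  rewrite -(ler_pM2r Cpos); apply: le_trans Gup; apply: le_trans Gl.
  by rewrite [2 * _]mulrC -mulrA ler_wpM2l.
have dl : s * delta <= 1 / 3 by nra.
nra.
Qed.

End LevelGap.

(** * Non-rich sets along chains *)

Section Chains.
Variables (R : realFieldType) (T : finType).
Implicit Types (Y A B : {set T}) (phi : {set T} -> R).

(** Double counting: each [k]-set in [Y] survives the removal of exactly [#|Y| - k] points. *)
Lemma level_avg_remove Y k phi : (k < #|Y|)%N ->
  \sum_(x in Y) level_avg (Y :\ x) k phi = #|Y|%:R * level_avg Y k phi.
Proof.
move=> kY.
have cYx x : x \in Y -> #|Y :\ x| = #|Y|.-1 by move=> xY; rewrite [in RHS](cardsD1 x) xY.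
have C0 : ('C(#|Y|, k)%:R : R) != 0 by rewrite pnatr_eq0 -lt0n bin_gt0 ltnW.
have C1 : ('C(#|Y|.-1, k)%:R : R) != 0.
  by rewrite pnatr_eq0 -lt0n bin_gt0 -ltnS prednK // (leq_ltn_trans _ kY).
have -> : \sum_(x in Y) level_avg (Y :\ x) k phi =
    (\sum_(x in Y) \sum_(B : {set T} | (B \subset Y :\ x) && (#|B| == k)) phi B) /
    'C(#|Y|.-1, k)%:R.
  by rewrite mulr_suml; apply: eq_bigr => x xY; rewrite /level_avg cYx.
rewrite (exchange_big_dep (fun B : {set T} => (B \subset Y) && (#|B| == k))) /=; last first.
  by move=> x B xY /andP[BY ->]; rewrite (subset_trans BY) ?subsetDl.
rewrite (eq_bigr (fun B : {set T} => (#|Y| - k)%:R * phi B)); last first.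
  move=> B /andP[BY /eqP Bk]; rewrite sumr_const mulr_natl; congr (_ *+ _).
  rewrite -Bk -cardsDS //; apply: eq_card => x.
  by rewrite [LHS]unfold_in /= Bk eqxx andbT subsetD1 BY in_setD andbC.
rewrite -mulr_sumr /level_avg; apply/eqP; rewrite mulrA eqr_div //; apply/eqP.
rewrite mulrAC -natrM -mulnC mulrAC -natrM mul_bin_down.
by rewrite [('C(_, _) * _)%N]mulnC.
Qed.

(** Double counting: each set of size [k.+1] arises once from each of its points. *)
Lemma level_avg_add Y k phi : (k < #|Y|)%N ->
  \sum_(x in Y) level_avg (Y :\ x) k (fun A => phi (x |: A)) =
  #|Y|%:R * level_avg Y k.+1 phi.
Proof.
move=> kY.
have cYx x : x \in Y -> #|Y :\ x| = #|Y|.-1 by move=> xY; rewrite [in RHS](cardsD1 x) xY.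
have C0 : ('C(#|Y|, k.+1)%:R : R) != 0 by rewrite pnatr_eq0 -lt0n bin_gt0.
have C1 : ('C(#|Y|.-1, k)%:R : R) != 0.
  by rewrite pnatr_eq0 -lt0n bin_gt0 -ltnS prednK // (leq_ltn_trans _ kY).
have -> : \sum_(x in Y) level_avg (Y :\ x) k (fun A => phi (x |: A)) =
    (\sum_(x in Y) \sum_(B : {set T} | (B \subset Y) && (#|B| == k.+1) && (x \in B)) phi B) /
    'C(#|Y|.-1, k)%:R.
  rewrite mulr_suml; apply: eq_bigr => x xY; rewrite /level_avg cYx //; congr (_ / _).
  rewrite [RHS](reindex_onto (fun B => x |: B) (fun B => B :\ x)) /=; last first.
    by move=> B /andP[_ xB]; rewrite setD1K.
  apply: eq_bigl => B; rewrite subsetD1 setU11 andbT subUset sub1set xY /=.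
  rewrite cardsU1; case: (boolP (x \in B)) => xB /=.
    rewrite andbF; apply/esym/negbTE/negP => /andP[_ /eqP e].
    by move: xB; rewrite -e !inE eqxx.
  by rewrite setU1K // eqxx !andbT add1n eqSS.
rewrite (exchange_big_dep (fun B : {set T} => (B \subset Y) && (#|B| == k.+1))) /=; last first.
  by move=> x B xY /andP[].
rewrite (eq_bigr (fun B : {set T} => k.+1%:R * phi B)); last first.
  move=> B /andP[BY /eqP Bk]; rewrite sumr_const mulr_natl; congr (_ *+ _).
  rewrite -Bk; apply: eq_card => x; rewrite unfold_in BY Bk eqxx /=.
  by case: (boolP (x \in B)) => xB; rewrite ?andbF // (subsetP BY).
rewrite -mulr_sumr /level_avg; apply/eqP; rewrite mulrA eqr_div //; apply/eqP.
rewrite mulrAC -natrM [RHS]mulrAC -natrM mul_bin_diag.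
by rewrite mulnC.
Qed.

(* Move an element [x] of [Y] into the set of a family [M i0] containing the
   empty set: averaging over [x], this removes the bottom level of [M i0] and
   only drops the top levels of the other families. *)
Lemma chain_sum (I : finType) Y (M : I -> pred {set T}) :
  (forall A : I -> {set T}, (forall i, A i \subset Y) ->
     (forall i j, i != j -> [disjoint A i & A j]) -> exists i, M i (A i)) ->
  #|Y|.+1%:R <= \sum_i \sum_(k < #|Y|.+1) level_avg Y k (fun A => (M i A)%:R) :> R.
Proof.
move: {2}#|Y| (erefl #|Y|) => N; elim: N Y M => [|N IH] Y M cY crossM.
  have Y0 : Y = set0 by apply/eqP; rewrite -cards_eq0 cY.
  have [||i Mi] := crossM (fun=> set0); [by move=> i; exact: sub0set| |].
    by move=> i j _; rewrite -setI_eq0 set0I.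
  rewrite (bigD1 i) //= cY big_ord1 -[leLHS]addr0; apply: lerD.
    rewrite /level_avg cY bin0 divr1 (bigD1 set0) ?sub0set ?cards0 //= Mi lerDl.
    by apply: sumr_ge0 => B _; exact: ler0n.
  apply: sumr_ge0 => j _; rewrite big_ord1 /level_avg mulr_ge0 ?invr_ge0 ?ler0n //.
  by apply: sumr_ge0 => B _; exact: ler0n.
have [||i0 Mi0] := crossM (fun=> set0); [by move=> i; exact: sub0set| |].
  by move=> i j _; rewrite -setI_eq0 set0I.
(* Disjoint sets in [Y :\ x] lift to [Y] by giving [x] to the set of index [i0] alone, so the
   hypothesis passes to [M' x]. *)
pose M' x i A := if i == i0 then M i (x |: A) else M i A.
have step x : x \in Y -> N.+1%:R <=
    \sum_i \sum_(k < N.+1) level_avg (Y :\ x) k (fun A => (M' x i A)%:R) :> R.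
  move=> xY.
  have cYx : #|Y :\ x| = N by apply/eqP; rewrite -eqSS -cY (cardsD1 x Y) xY.
  rewrite -cYx; apply: IH => // A AY dA.
  pose A' i := if i == i0 then x |: A i else A i.
  have xA i : x \notin A i by apply: contraTN (AY i) => xAi; apply/subsetPn; exists x => //; rewrite !inE eqxx.
  have [||i Mi] := crossM A'.
  - move=> i; have Ai : A i \subset Y by rewrite (subset_trans (AY i)) ?subsetDl.
    by rewrite /A'; case: ifP => // _; rewrite subUset sub1set xY.
  - move=> i j ij; have dij := dA i j ij; rewrite /A'; case: ifP => ii0; case: ifP => ji0 //.
    + by move: ij; rewrite (eqP ii0) (eqP ji0) eqxx.
    + by rewrite disjointsU dij andbT disjoints1.
    + by rewrite disjoint_sym disjointsU [X in _ && X]disjoint_sym dij andbT disjoints1.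
  - exists i; rewrite /M'; move: Mi; rewrite /A'; by case: ifP.
pose L i k := level_avg Y k (fun A => (M i A)%:R) : R.
have L0 i k : 0 <= L i k.
  by rewrite /L /level_avg mulr_ge0 ?invr_ge0 ?ler0n ?sumr_ge0.
have tot : #|Y|%:R * N.+1%:R <= #|Y|%:R * (\sum_i \sum_(k < N.+1)
    (if i == i0 then L i k.+1 else L i k)) :> R.
  apply: (@le_trans _ _ (\sum_(x in Y) N.+1%:R)).
    by rewrite sumr_const mulr_natl.
  apply: le_trans (ler_sum _ step) _; rewrite exchange_big /= mulr_sumr.
  apply: ler_sum => i _; rewrite exchange_big /= mulr_sumr; apply: ler_sum => k _.
  have kY : (k < #|Y|)%N by rewrite cY.
  rewrite le_eqVlt; apply/orP; left; apply/eqP; rewrite /M' /L; case: ifP => _.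
    exact: (level_avg_add (fun A => (M i A)%:R) kY).
  exact: (level_avg_remove (fun A => (M i A)%:R) kY).
rewrite ler_pM2l in tot; last by rewrite ltr0n cY.
rewrite cY -natr1.
(* The additional unit is level 0 of [M i0], which has density 1. *)
apply: (@le_trans _ _ (\sum_i \sum_(k < N.+1) (if i == i0 then L i k.+1 else L i k) +
   \sum_i (i == i0)%:R)).
  by apply: lerD => //; rewrite (bigD1 i0) //= eqxx big1 ?addr0 // => i /negbTE ->.
rewrite -big_split /=; apply: ler_sum => i _; case: eqP => [->|_].
  rewrite [leRHS]big_ord_recl [leLHS]addrC; apply: lerD => //.
  rewrite /level_avg bin0 divr1 (bigD1 set0) ?sub0set ?cards0 //= Mi0 lerDl.
  by apply: sumr_ge0 => B _; exact: ler0n.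
rewrite addr0 [leRHS]big_ord_recr /= lerDl; exact: L0.
Qed.

End Chains.

(** * Copies of the multipartite graph from disjoint sets *)

Section Copies.
Variables (n s t : nat).
Implicit Types (F : {set {set 'I_n}}) (A B : {set 'I_n}).

Lemma graph_freeP F :
  reflect (forall f : 'I_s * 'I_t -> {set 'I_n}, injective f ->
      (forall x, f x \in F) -> (forall x y, x.1 != y.1 -> [disjoint f x & f y]) -> False)
    (graph_free (@complete_multipartite s t) F).
Proof.
apply: (iffP idP) => [free f fI fF fd|noF].
  move/negP: free; apply; apply/existsP; exists (finfun f); apply/and3P; split.
  - by apply/injectiveP => x y; rewrite !ffunE => /fI.
  - by apply/forallP => x; rewrite ffunE.
  - apply/forallP => x; apply/forallP => y; apply/implyP => xy.
    rewrite !ffunE /kneser_cube fd // andbT (inj_eq fI).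
    by apply: contraNneq xy => ->.
apply/negP => /existsP[f /and3P[/injectiveP fI /forallP fF /forallP fd]].
apply: (noF f) => // x y xy.
by have /forallP/(_ y)/implyP/(_ xy)/andP[] := fd x.
Qed.

(** These are the rich sets. Facets are counted by their deleted points. *)
Definition many_subfaces F A : bool := (t <= #|[set x in A | A :\ x \in F]|)%N.

(** Otherwise [t] facets in [F] of each [P i] would form the parts of a copy. *)
Lemma many_subfaces_cross F (P : 'I_s -> {set 'I_n}) : (2 <= t)%N ->
  graph_free (@complete_multipartite s t) F ->
  (forall i j, i != j -> [disjoint P i & P j]) -> exists i, ~~ many_subfaces F (P i).
Proof.
move=> t2 /graph_freeP free dP; apply/existsP; apply: contraT => /existsPn all; exfalso; apply: (free (fun p =>
  P p.1 :\ enum_val (widen_ord (negbNE (all p.1)) p.2))).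
- pose e i (j : 'I_t) := enum_val (widen_ord (negbNE (all i)) j).
  have eP i j : e i j \in P i.
    by have := enum_valP (widen_ord (negbNE (all i)) j); rewrite inE => /andP[].
  have e_inj i : injective (e i).
    by move=> j j' /enum_val_inj /(congr1 val) /= /val_inj.
  move=> [i j] [i' j'] /= eqP'; rewrite -/(e i j) -/(e i' j') in eqP'.
  have [ii'|ii'] := eqVneq i i'.
    subst i'; congr (_, _); apply: (@e_inj i); apply/eqP/negPn/negP => ne.
    have E0 : (e i j \in P i :\ e i j) = false by rewrite !inE eqxx.
    by rewrite eqP' !inE ne eP in E0.
  (* As [t >= 2], another deleted point of the same block remains in the facet. Facets from
     different blocks are therefore nonempty and disjoint, hence distinct. *)
  pose j0 : 'I_t := Ordinal (ltnW t2); pose j1 : 'I_t := Ordinal t2.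
  have [j2 j2j] : exists j2, e i j2 != e i j.
    have [->|] := eqVneq j j0; last by exists j0; rewrite (inj_eq (@e_inj i)) eq_sym.
    by exists j1; rewrite (inj_eq (@e_inj i)).
  have : e i j2 \in P i :\ e i j by rewrite !inE j2j eP.
  rewrite eqP' !inE => /andP[_ x'].
  by have := disjointFr (dP i i' ii') (eP i j2); rewrite x'.
- move=> [i j] /=; have := enum_valP (widen_ord (negbNE (all i)) j).
  by rewrite inE => /andP[].
- move=> [i j] [i' j'] /= /dP; apply: disjointW; exact: subsetDl.
Qed.

End Copies.

(** For [t = 2] a part may also consist of a set and one of its facets. This alternative, unlike
    richness, is what [level_gap_small] takes as input; [2 <= m] keeps the facets nonempty. *)
Lemma block_missing (n m k : nat) (F : {set {set 'I_n}}) (P : 'I_k.+3 -> {set 'I_n}) :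
  (2 <= m)%N -> graph_free (@complete_multipartite k.+3 2) F -> is_block_partition m P ->
  exists i, (P i \notin F) || [forall x in P i, P i :\ x \notin F].
Proof.
move=> m2 /graph_freeP free [cP dP]; apply/existsP; apply: contraT => /existsPn all; exfalso.
have PF i : P i \in F by have := all i; rewrite negb_or negbK => /andP[].
have ex i : exists x, (x \in P i) && (P i :\ x \in F).
  have := all i; rewrite negb_or => /andP[_]; rewrite negb_forall => /existsP[x].
  by rewrite negb_imply negbK => xP; exists x.
have [w wP] : exists w, forall i, w i \in P i /\ P i :\ w i \in F.
  by exists (fun i => xchoose (ex i)) => i; exact: (andP (xchooseP (ex i))).
pose f (p : 'I_k.+3 * 'I_2) := if p.2 == 0 then P p.1 else P p.1 :\ w p.1.
have fs p : f p \subset P p.1 by rewrite /f; case: ifP => // _; exact: subsetDl.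
have f0 p : f p != set0.
  rewrite -card_gt0 /f; case: ifP => _; first by rewrite cP ltnW.
  by have := m2; rewrite -(cP p.1) (cardsD1 (w p.1)) (wP p.1).1 add1n ltnS.
have fd p q : p.1 != q.1 -> [disjoint f p & f q].
  by move=> /dP; apply: disjointW.
apply: (free f) => //.
- move=> p q fpq; have [e1|/fd] := eqVneq p.1 q.1; last first.
    by rewrite fpq -setI_eq0 setIid (negbTE (f0 q)).
  case: p q e1 fpq => [i a] [i' b] /= <- {i'}; rewrite /f /= => fpq; congr (_, _).
  apply: val_inj; case: a b fpq => [[|[|//]] ?] [[|[|//]] ?] //= e.
    by have := (wP i).1; rewrite e !inE eqxx.
  by have := (wP i).1; rewrite -e !inE eqxx.
- by move=> p; rewrite /f; case: ifP => _; [exact: PF|exact: (wP _).2].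
Qed.

(** * Densities of missing and of non-rich sets *)

Section Densities.
Variables (R : realFieldType) (n s t : nat) (F : {set {set 'I_n}}).
Let p := level_density R (fun A : {set 'I_n} => A \notin F).
Let p' := level_density R (fun A : {set 'I_n} => ~~ many_subfaces t F A).

Lemma level_density_ge0 (M : pred {set 'I_n}) k : 0 <= level_density R M k.
Proof. by rewrite level_densityE divr_ge0. Qed.

Lemma level_density_le1 (M : pred {set 'I_n}) k : (k <= n)%N -> level_density R M k <= 1.
Proof.
move=> kn; rewrite -[leRHS](@level_avg_cst _ _ [set: 'I_n] k) ?cardsT ?card_ord //.
by apply: ler_level_avg => B _ _; rewrite -[1]/(1%:R) ler_nat leq_b1.
Qed.

Lemma level_density_perm (M : pred {set 'I_n}) (B : {set 'I_n}) :
  avg (fun g : {perm 'I_n} => (M (g @: B))%:R) = level_density R M #|B|.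
Proof. exact: (avg_imset B (fun A => (M A)%:R)). Qed.

(** A non-rich set of size [k.+1] has fewer than [t] facets in [F], so a random facet of it is
    missing with probability at least [(k + 1 - t) / (k + 1)]. *)
Lemma shadow_density k : (k < n)%N ->
  p' k.+1 * (k.+1 - t)%:R <= p k * k.+1%:R.
Proof.
move=> kn; have [|S _ cS] := @subset_of_card _ [set: 'I_n] k.+1.
  by rewrite cardsT card_ord.
rewrite /p' -cS -level_density_perm -avgZr.
have -> : p k * #|S|%:R = \sum_(x in S) avg (fun g : {perm 'I_n} => (g @: (S :\ x) \notin F)%:R).
  rewrite (eq_bigr (fun=> p k)) => [|x xS]; first by rewrite sumr_const mulr_natr.
  rewrite (level_density_perm (fun A => A \notin F)); congr (level_density _ _ _).
  by apply/eqP; rewrite -eqSS -cS (cardsD1 x S) xS.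
rewrite -avg_sum; apply: ler_avg => g.
rewrite -natrM -natr_sum ler_nat; case: (boolP (many_subfaces _ _ _)) => // few.
rewrite mul1n leq_subLR.
have gD x : g @: (S :\ x) = (g @: S) :\ g x.
  apply/setP => y; rewrite -[y](permKV g) !inE !mem_imset ?inE ?(inj_eq (@perm_inj _ g)) //;
  exact: perm_inj.
pose E := [set x in S | g @: (S :\ x) \in F].
have cE : (#|E| < t)%N.
  move: few; rewrite -ltnNge; apply: leq_ltn_trans.
  rewrite -(card_imset _ (@perm_inj _ g)); apply: subset_leq_card; apply/subsetP => y.
  move=> /imsetP[x]; rewrite inE => /andP[xS xF] ->.
  by rewrite inE imset_f // -gD.
have -> : (\sum_(x in S) (g @: (S :\ x) \notin F) = #|S :\: E|)%N.
  rewrite -sum1_card [LHS]big_mkcond [RHS]big_mkcond; apply: eq_bigr => x _.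
  by rewrite !inE; case: (x \in S) => //=; case: (_ \in F).
have ES : E \subset S by apply/subsetP => x; rewrite inE => /andP[].
by rewrite -(cardsID E S) (setIidPr ES) leq_add2r ltnW.
Qed.

(** Apply [chain_sum] to [s] copies of one family [M]: all sets below level [a], the non-rich sets
    up to level [K], nothing above. Disjoint sets outside [M] have size at least [a], and one of
    them is not rich, hence larger than [K]; together they would exceed [n] points. The truncation
    keeps only levels on which the binomial coefficients can be compared. *)
Lemma density_sum (a : nat) : (2 <= t)%N -> (0 < s)%N -> (a * s <= n)%N ->
  graph_free (@complete_multipartite s t) F ->
  n.+1%:R / s%:R - a%:R <= \sum_(a <= k < (n - a * s.-1).+1) p' k.
Proof.
move=> t2 s0 asn free; set K := (n - a * s.-1)%N.
have aK : (a <= K)%N by rewrite /K; case: s s0 asn => // s' _ /=; rewrite mulnS; lia.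
have Kn : (K <= n)%N by exact: leq_subr.
pose M (A : {set 'I_n}) := ~~ ((many_subfaces t F A && (a <= #|A|)%N) || (K < #|A|)%N).
have crossM (A : 'I_s -> {set 'I_n}) : (forall i, A i \subset [set: 'I_n]) ->
    (forall i j, i != j -> [disjoint A i & A j]) -> exists i, M (A i).
  move=> _ dA; apply/existsP; apply: contraT => /existsPn all; exfalso.
  have Aa i : (a <= #|A i|)%N.
    by have := all i; rewrite negbK => /orP[/andP[]//|/ltnW]; exact: leq_trans.
  have [i Mi] := many_subfaces_cross t2 free dA.
  have Ki : (K < #|A i|)%N by have := all i; rewrite negbK (negbTE Mi).
  have : (\sum_j #|A j| <= n)%N.
    rewrite (eq_bigr (fun j => \sum_(x < n) (x \in A j)))%N => [|j _]; last first.
      by rewrite -sum1_card big_mkcond; apply: eq_bigr => x _; case: (x \in A j).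
    rewrite exchange_big -[leqRHS]card_ord -sum1_card; apply: leq_sum => x _ /=.
    have [/existsP[j xj]|/existsPn no] := boolP [exists j, x \in A j].
      rewrite (bigD1 j) //= xj big1 // => l lj.
      by rewrite (disjointFr (dA j l _) xj) // eq_sym.
    by rewrite big1 // => j _; rewrite (negbTE (no j)).
  rewrite (bigD1 i) //=; apply/negP; rewrite -ltnNge.
  apply: (@leq_trans (K.+1 + \sum_(j < s | j != i) a)).
    by rewrite sum_nat_const cardC1 card_ord mulnC /K addSn subnK // (leq_trans _ asn) // leq_mul2l leq_pred orbT.
  by apply: leq_add => //; apply: leq_sum => j _.
have := @chain_sum R _ 'I_s [set: 'I_n] (fun=> M) crossM.
rewrite sumr_const cardsT !card_ord -[_ *+ s]mulr_natr.
rewrite -ler_pdivrMr ?ltr0n // => le1; rewrite lerBlDl; apply: le_trans le1 _.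
rewrite -(big_mkord xpredT (fun k => level_avg [set: 'I_n] k (fun A => (M A)%:R))).
rewrite (@big_cat_nat _ _ _ a) //=; last by rewrite ltnW // ltnS (leq_trans aK).
apply: lerD.
  apply: (@le_trans _ _ (\sum_(0 <= i < a) 1)).
    rewrite !big_nat; apply: ler_sum => k /andP[_ ka].
    by apply: (level_density_le1 M); rewrite (leq_trans (ltnW ka)) // (leq_trans aK).
  by rewrite sumr_const_nat subn0.
rewrite (@big_cat_nat _ _ _ K.+1) //=; last by rewrite ltnW.
rewrite -[leRHS]addr0; apply: lerD.
  rewrite !big_nat; apply: ler_sum => k /andP[ak kK]; apply: ler_level_avg => A _ cA.
  by rewrite /M cA ak ltnNge -ltnS kK andbT orbF.
rewrite big_nat big1 // => k /andP[Kk kn]; rewrite (@eq_level_avg _ _ _ _ _ (fun=> 0)).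
  by rewrite /level_avg big1 ?mul0r.
by move=> A _ cA; rewrite /M cA Kk orbT.
Qed.

End Densities.

(** * Comparison of binomial coefficients *)

Section Binomials.
Implicit Types (n i j : nat).

Lemma leq_bin_double n i : (3 * i + 2 <= n)%N -> (2 * 'C(n, i) <= 'C(n, i.+1))%N.
Proof.
move=> h; rewrite -(leq_pmul2l (ltn0Sn i)) mul_bin_left mulnA leq_mul2r.
by apply/orP; right; lia.
Qed.

Lemma leq_bin_half n i j : (i <= j)%N -> (2 * j <= n)%N -> ('C(n, i) <= 'C(n, j))%N.
Proof.
move=> ij; elim: j ij => [|j IH]; first by rewrite leqn0 => /eqP ->.
rewrite leq_eqVlt => /orP[/eqP -> //|]; rewrite ltnS => ij jn.
apply: leq_trans (IH ij _) _; first by lia.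
by rewrite -(leq_pmul2l (ltn0Sn j)) mul_bin_left leq_mul2r; apply/orP; right; lia.
Qed.

(** Unimodality; beyond the middle, reflect [j] to [n - j]. *)
Lemma leq_bin_mid n i j : (i <= j)%N -> (j <= n - i)%N -> (i <= n)%N ->
  ('C(n, i) <= 'C(n, j))%N.
Proof.
move=> ij jn i_n; have [h|h] := leqP (2 * j) n; first exact: leq_bin_half.
have jn' : (j <= n)%N by lia.
by rewrite -(bin_sub jn'); apply: leq_bin_half; lia.
Qed.

(** In this range the coefficients at least double, so the sum is dominated geometrically. *)
Lemma sum_bin_le n j : (3 * j <= n + 1)%N -> (\sum_(0 <= i < j) 'C(n, i) <= 'C(n, j))%N.
Proof.
elim: j => [|j IH] h; first by rewrite big_geq.
rewrite big_nat_recr //=; apply: leq_trans (leq_bin_double _); last by lia.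
by rewrite mul2n -addnn leq_add2r IH //; lia.
Qed.

End Binomials.

(** * Minimal cost of densities with a prescribed sum *)

Section LinearProgram.
Variables (R : realFieldType) (V q : nat -> R) (a m K : nat) (rho delta : R).
Hypotheses (am : (a <= m)%N) (mK : (m < K)%N).
Hypotheses (q0 : forall k, 0 <= q k) (q1 : forall k, (k <= K)%N -> q k <= 1).
Hypothesis V0 : 0 <= V m.
Hypothesis Vlow : forall k, (a <= k < m)%N -> 2 * V k <= V m.
Hypothesis Vhigh : forall k, (m <= k <= K)%N -> V m <= V k.
Hypothesis Vdouble : 2 * V m <= V m.+1.
Hypothesis delta0 : 0 <= delta.
Hypothesis qsum : m%:R + rho - a%:R <= \sum_(a <= k < K.+1) q k.
Hypothesis gap : rho + delta <= q m \/ delta <= q m.+1.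

(** The cheapest choice fills all levels below [m] and puts [rho] on level [m]. A deficit [Y] below
    [m] saves at most [V m / 2] per unit but must be made up at price at least [V m]. The gap forces
    an extra cost. In the first case, averaging [rho + delta <= Z] and [rho + Y <= Z] gains
    [delta / 2]. In the second, mass [delta] sits on level [m.+1], at twice the price. *)
Lemma level_program :
  \sum_(a <= k < m) V k + V m * (rho + delta / 2) <= \sum_(a <= k < K.+1) V k * q k.
Proof.
have mK1 : (m <= K.+1)%N by rewrite ltnW // ltnS ltnW.
pose Y := \sum_(a <= k < m) (1 - q k); pose Z := \sum_(m <= k < K.+1) q k.
have YE : Y = m%:R - a%:R - \sum_(a <= k < m) q k.
  by rewrite /Y sumrB sumr_const_nat natrB.
have YZ : rho + Y <= Z.
  by move: qsum; rewrite (big_cat_nat am mK1) /= -/Z YE; lra.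
have low : \sum_(a <= k < m) V k - V m / 2 * Y <= \sum_(a <= k < m) V k * q k.
  rewrite /Y mulr_sumr -sumrB !big_nat; apply: ler_sum => k kr.
  have := Vlow kr; have q1k : q k <= 1.
    by apply: q1; case/andP: kr => _ km; rewrite ltnW // (ltn_trans km mK).
  have := q0 k; nra.
have high (k0 : nat) : (m <= k0 <= K)%N ->
    V m * Z + (V k0 - V m) * q k0 <= \sum_(m <= k < K.+1) V k * q k.
  move=> k0r; have -> : \sum_(m <= k < K.+1) V k * q k =
      V m * Z + \sum_(m <= k < K.+1) (V k - V m) * q k.
    by rewrite /Z mulr_sumr -big_split /=; apply: eq_bigr => k _; ring.
  rewrite lerD2l (bigD1_seq k0) ?iota_uniq //=; last by rewrite mem_index_iota ltnS.
  rewrite lerDl big_seq_cond sumr_ge0 // => k /andP[]; rewrite mem_index_iota ltnS => kr _.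
  by rewrite mulr_ge0 // subr_ge0 Vhigh.
rewrite (big_cat_nat am mK1) /=.
have mr : (m <= m <= K)%N by rewrite leqnn ltnW.
have mr1 : (m <= m.+1 <= K)%N by rewrite leqnSn.
have Y0 : 0 <= Y.
  rewrite /Y big_nat sumr_ge0 // => k /andP[_ km].
  by rewrite subr_ge0 q1 // ltnW // (ltn_trans km mK).
case: gap => g.
  have Zg : rho + delta <= Z.
    apply: le_trans g _; rewrite /Z (bigD1_seq m) ?iota_uniq //=; last first.
      by rewrite mem_index_iota leqnn ltnS ltnW.
    by rewrite lerDl sumr_ge0.
  have := high m mr; rewrite subrr mul0r addr0.
  have VZ : V m * (rho + delta / 2 + Y / 2) <= V m * Z by rewrite ler_wpM2l //; lra.
  move: low VZ; rewrite !mulrDr; lra.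
have high1 := high m.+1 mr1.
have VZ : V m * (rho + Y) <= V m * Z by rewrite ler_wpM2l.
have Vd : V m * delta <= (V m.+1 - V m) * q m.+1.
  apply: (@le_trans _ _ (V m * q m.+1)); first by rewrite ler_wpM2l.
  by apply: ler_wpM2r; [exact: q0|rewrite lerBrDr; move: Vdouble; lra].
have VY : 0 <= V m * Y by exact: mulr_ge0.
have Vd0 : 0 <= V m * delta by exact: mulr_ge0.
move: low VZ high1 Vd; set x := (_ - _) * _; rewrite !mulrDr; lra.
Qed.

End LinearProgram.

(** * Lower bound for the number of missing sets *)

Section MissingSets.
Variables (R : realFieldType) (n m k t : nat) (F : {set {set 'I_n}}).
Let p := level_density R (fun A : {set 'I_n} => A \notin F).
Let p' := level_density R (fun A : {set 'I_n} => ~~ many_subfaces t F A).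

Lemma missing_sum : 2 ^+ n - #|F|%:R = \sum_(0 <= i < n.+1) p i * 'C(n, i)%:R.
Proof.
have -> : 2 ^+ n - #|F|%:R = #|~: F|%:R :> R.
  have := cardsC F; rewrite -[RHS]cardsT -powersetT card_powerset cardsT card_ord => e.
  by rewrite -natrX -e natrD addrC addKr.
rewrite (eq_big_nat _ _ (F2 := fun i =>
   #|[set A : {set 'I_n} | (#|A| == i) && (A \notin F)]|%:R)); last first.
  by move=> i /andP[_ i_n]; rewrite /p level_densityE divfK // pnatr_eq0 -lt0n bin_gt0.
rewrite -natr_sum; congr (_%:R).
rewrite big_mkord -sum1_card (partition_big (fun A : {set 'I_n} => inord #|A| : 'I_n.+1) predT) //=.
apply: eq_bigr => i _; rewrite -sum1_card; apply: eq_bigl => A.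
rewrite !inE andbC; congr (_ && _); rewrite -val_eqE /= inordK // ltnS.
by rewrite -[leqRHS](card_ord n) max_card.
Qed.

Hypotheses (n_lo : (k.+3 * m <= n.+1)%N) (n_hi : (n <= k.+3 * m)%N).
Hypotheses (m5 : (5 <= m)%N) (mt : (2 * t <= m)%N) (t2 : (2 <= t)%N).
Hypothesis free : graph_free (@complete_multipartite k.+3 t) F.
Variable delta : R.
Let rho : R := n.+1%:R / k.+3%:R - m%:R.
Hypothesis delta0 : 0 <= delta.
Hypothesis gap : rho + delta <= p m.-1 \/ delta <= p m.

(** The program is run on levels from [a], half of [m] rounded up. In the loss factor, [t] comes
    from passing to facets at sizes at least [m./2], and 1 from the levels below [a.-1], which are
    discarded. *)
Lemma missing_lower :
  (1 - t.+1%:R / m./2%:R) *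
    ((binom_le n (m - 2))%:R + 'C(n, m.-1)%:R * (rho + delta / 2)) <= 2 ^+ n - #|F|%:R.
Proof.
pose a := uphalf m; have aE : (a + m./2 = m)%N by rewrite /a uphalf_half -addnA addnn odd_double_half.
have am2 : (m./2 <= a)%N by rewrite /a uphalf_half leq_addl.
have a2 : (a <= m./2 + 1)%N by rewrite /a uphalf_half addnC leq_add2l; case: (odd m).
have m2 : (2 <= m./2)%N by rewrite (half_leq m5).
pose K := (n - a * k.+2)%N.
have nm : (3 * m <= n.+1)%N by nia.
have asn : (a * k.+3 <= n)%N by nia.
have mK : (m < K)%N by rewrite /K; nia.
have Kn : (K <= n - m)%N by rewrite /K leq_sub2l //; nia.
have a0 : (0 < a)%N by lia.
have am : (a < m)%N by lia.
have h0N : (0 < m./2)%N by lia.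
have m0 : (0 < m)%N by lia.
have mp : m = m.-1.+1 by lia.
have mpp : m.-1 = m.-2.+1 by lia.
have m2E : (m - 2).+1 = m.-1 by lia.
have am1 : (a.-1 <= m.-1)%N by lia.
have a3 : (3 * a.-1 <= n + 1)%N by lia.
have a1n : (a.-1 <= n.+1)%N by lia.
have aK1 : (a.-1 <= K)%N by lia.
have Kn1 : (K <= n.+1)%N by lia.
have cnt : (m.-1 - a.-1 = m./2)%N by lia.
have mn2 : (2 * m.-1 <= n)%N by lia.
have mn3 : (3 * m.-1 + 2 <= n)%N by lia.
have mn4 : (3 * m.-2 + 2 <= n)%N by lia.
have mn1 : (m.-1 <= n)%N by lia.
have mn5 : (2 * m.-2 <= n)%N by lia.
have th0 : (t <= m./2)%N by lia.
have iK_n i : (i <= K)%N -> (i <= n)%N by lia.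
have im_pred i : (i < m)%N -> (i.-1 <= m.-1)%N /\ (i.-1 <= m.-2)%N by lia.
have im_half i : (i < m.-1)%N -> (2 * i <= n)%N by lia.
have mid i : (m <= i)%N -> (i <= K)%N -> (m.-1 <= i.-1)%N /\ (i.-1 <= n - m.-1)%N by lia.
have ai_facts i : (a <= i)%N -> (i <= K)%N ->
    [/\ (0 < i)%N, i = i.-1.+1, (i.-1 < n)%N & (m./2 <= i)%N].
  by move=> ai iK; split; lia.
pose V i : R := 'C(n, i.-1)%:R; pose q i := Num.max (p' i) (p i.-1).
have V0 i : 0 <= V i by exact: ler0n.
have q0 i : 0 <= q i by rewrite le_max level_density_ge0.
have q1 i : (i <= K)%N -> q i <= 1.
  move=> iK; have i_n := iK_n i iK.
  by rewrite ge_max !level_density_le1 // (leq_trans (leq_pred i)).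
have Vlow i : (a <= i < m)%N -> 2 * V i <= V m.
  move=> /andP[ai im]; apply: (@le_trans _ _ (2 * V m.-1)).
    by rewrite ler_pM2l // ler_nat; exact: leq_bin_half (im_pred i im).2 mn5.
  rewrite -natrM ler_nat.
  by rewrite [in X in (_ <= X)%N]mp mpp; apply: leq_bin_double.
have Vhigh i : (m <= i <= K)%N -> V m <= V i.
  by move=> /andP[mi iK]; have [? ?] := mid i mi iK; rewrite ler_nat; exact: leq_bin_mid.
have Vdouble : 2 * V m <= V m.+1.
  by rewrite -natrM ler_nat /= [in X in (_ <= X)%N]mp; exact: leq_bin_double.
have rho_a : m%:R + rho - a%:R = n.+1%:R / k.+3%:R - a%:R by rewrite /rho; ring.
have qsum : m%:R + rho - a%:R <= \sum_(a <= i < K.+1) q i.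
  rewrite rho_a; apply: le_trans (density_sum _ t2 _ asn free) _ => //.
  by apply: ler_sum => i _; rewrite le_max lexx.
have gap' : rho + delta <= q m \/ delta <= q m.+1.
  by case: gap => g; [left|right]; rewrite le_max g orbT.
have prog := level_program (ltnW am) mK q0 q1 (V0 m) Vlow Vhigh Vdouble delta0 qsum gap'.
pose B : R := (binom_le n (m - 2))%:R; pose Z := 'C(n, m.-1)%:R * (rho + delta / 2).
have h0 : 0 < m./2%:R :> R by rewrite ltr0n.
have shift (f : nat -> R) l : \sum_(a <= i < l) f i = \sum_(a.-1 <= i < l.-1) f i.+1.
  by rewrite -{1}(prednK a0) big_add1.
(* The discarded sum [L] is at most ['C(n, a.-1)], and each of the [m./2] terms kept is at least
   that. *)
have Vsum : (1 - 1 / m./2%:R) * B <= \sum_(a <= i < m) V i.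
  pose L : R := \sum_(0 <= i < a.-1) 'C(n, i)%:R.
  rewrite shift /V /=; set S := \sum_(_ <= i < _) _.
  have BE : B = L + S.
    rewrite /B /binom_le natr_sum -(big_mkord xpredT (fun i => 'C(n, i)%:R)).
    by rewrite m2E (@big_cat_nat _ _ _ a.-1).
  pose c : R := 'C(n, a.-1)%:R.
  have Lc : L <= c by rewrite /L -natr_sum ler_nat sum_bin_le.
  have Sc : m./2%:R * c <= S.
    have -> : m./2%:R * c = \sum_(a.-1 <= i < m.-1) c.
      by rewrite sumr_const_nat mulr_natl cnt.
    rewrite /S !big_nat; apply: ler_sum => i /andP[ai im].
    by rewrite ler_nat leq_bin_half // im_half.
  have L0 : 0 <= L by apply: sumr_ge0.
  have hL : m./2%:R * L <= L + S by have := ler_wpM2l (ltW h0) Lc; lra.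
  have Lh : L <= (L + S) / m./2%:R by rewrite ler_pdivlMr // mulrC.
  have -> : (1 - 1 / m./2%:R) * B = B - B / m./2%:R by ring.
  by rewrite BE; lra.
have rho0 : 0 <= rho.
  by rewrite /rho subr_ge0 ler_pdivlMr ?ltr0n // -natrM ler_nat mulnC.
have th : 0 <= 1 - t%:R / m./2%:R :> R.
  by rewrite subr_ge0 ler_pdivrMr // mul1r ler_nat.
have shad i : (a <= i < K.+1)%N -> (1 - t%:R / m./2%:R) * (V i * q i) <= p i.-1 * 'C(n, i.-1)%:R.
  move=> /andP[ai iK]; rewrite mulrCA [leRHS]mulrC ler_wpM2l // ?ler0n //.
  have p0 : 0 <= p i.-1 by exact: level_density_ge0.
  have t0 : 0 <= t%:R / m./2%:R :> R by rewrite divr_ge0 // ltW.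
  rewrite /q /Num.max; case: ifP => _; first by nra.
  have [i0N iE in1 ih] := ai_facts i ai iK; have i0 : 0 < i%:R :> R by rewrite ltr0n.
  have := shadow_density R t F in1; rewrite -iE -/(p _) -/(p' _) => sh.
  have p'0 : 0 <= p' i by exact: level_density_ge0.
  rewrite -(ler_pM2r i0); apply: le_trans sh.
  rewrite mulrAC [leRHS]mulrC; apply: ler_wpM2r => //.
  have it : i%:R - t%:R <= (i - t)%:R :> R.
    by rewrite lerBlDr -natrD ler_nat addnC -maxnE leq_maxr.
  apply: le_trans it; rewrite mulrBl mul1r lerB //.
  by rewrite mulrAC ler_pdivlMr // -!natrM ler_nat leq_mul2l ih orbT.
have big1' : \sum_(a <= i < K.+1) p i.-1 * 'C(n, i.-1)%:R <= 2 ^+ n - #|F|%:R.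
  pose G i := p i * 'C(n, i)%:R.
  have -> : 2 ^+ n - #|F|%:R = \sum_(0 <= i < a.-1) G i +
      (\sum_(a.-1 <= i < K) G i + \sum_(K <= i < n.+1) G i).
    by rewrite missing_sum -(big_cat_nat aK1 Kn1) -(big_cat_nat (leq0n _) a1n).
  rewrite shift /=.
  have pos (u v : nat) : 0 <= \sum_(u <= l < v) G l.
    by apply: sumr_ge0 => l _; rewrite mulr_ge0 ?level_density_ge0.
  by rewrite addrCA lerDl addr_ge0 ?pos.
apply: le_trans big1'.
apply: (@le_trans _ _ ((1 - t%:R / m./2%:R) * \sum_(a <= i < K.+1) V i * q i)); last first.
  by rewrite mulr_sumr !big_nat; apply: ler_sum => i /shad.
apply: le_trans (ler_wpM2l th prog); rewrite -/Z -/B.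
have Z0 : 0 <= Z by rewrite /Z mulr_ge0 // addr_ge0 // divr_ge0.
have B0 : 0 <= B by exact: ler0n.
apply: le_trans (ler_wpM2l th (lerD Vsum (lexx Z))).
have -> : t.+1%:R / m./2%:R = t%:R / m./2%:R + 1 / m./2%:R :> R by rewrite -natr1 mulrDl.
set x := t%:R / m./2%:R; set y := 1 / m./2%:R.
have x0 : 0 <= x by rewrite /x divr_ge0 // ltW.
have y0 : 0 <= y by rewrite /y divr_ge0 // ltW.
have xyB : 0 <= x * (y * B) by do 2!(apply: mulr_ge0 => //).
have yZ : 0 <= y * Z by apply: mulr_ge0.
move: xyB yZ; clearbody x y Z B; lra.
Qed.

End MissingSets.

(** * Free families defined by a weight *)

Section Weights.
Variables (n s t : nat).
Implicit Types (A B X Y : {set 'I_n}).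

(** If a union of [t] distinct members had weight only [tau], all of them would have the same trace
    on [X] and differ only outside [X], where at most [2 ^ #|~: X|] sets are available. So each
    union weighs at least [tau.+1], and [s] disjoint ones exceed the total weight. *)
Lemma weight_free X Y (tau : nat) : (2 ^ #|~: X| < t)%N ->
  (#|X| + #|Y| < s * tau.+1)%N ->
  graph_free (@complete_multipartite s t)
    [set A : {set 'I_n} | (tau <= #|A :&: X| + #|A :&: Y|)%N].
Proof.
move=> tX small; apply/graph_freeP => f fI fF fd.
pose U i := \bigcup_j f (i, j).
have Uw i : (tau < #|U i :&: X| + #|U i :&: Y|)%N.
  rewrite ltnNge; apply/negP => Ule.
  have fU j : f (i, j) \subset U i by exact: bigcup_sup.
  have trace j : f (i, j) :&: X = U i :&: X.
    apply/eqP; rewrite eqEcard setSI //=.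
    have := fF (i, j); rewrite inE => tle.
    rewrite -(leq_add2r #|U i :&: Y|) (leq_trans (leq_trans Ule tle)) //.
    by rewrite leq_add2l subset_leq_card // setSI.
  have gI : injective (fun j => f (i, j) :&: ~: X).
    move=> j j' e; suff /fI [] : f (i, j) = f (i, j') by [].
    by rewrite -[LHS](setID _ X) -[RHS](setID _ X) !setDE !trace e.
  have : (t <= #|powerset (~: X)|)%N.
    rewrite -[leqLHS]card_ord -(card_imset predT gI); apply: subset_leq_card.
    by apply/subsetP => _ /imsetP[j _ ->]; rewrite powersetE subsetIr.
  by rewrite card_powerset leqNgt tX.
have dU i i' : i != i' -> [disjoint U i & U i'].
  move=> ii'; apply/bigcup_disjointP => j' _; rewrite disjoint_sym.
  by apply/bigcup_disjointP => j _; apply: fd; rewrite /= eq_sym.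
have tot (Z : {set 'I_n}) : (\sum_i #|U i :&: Z| <= #|Z|)%N.
  rewrite (eq_bigr (fun i => \sum_(x in Z) (x \in U i)))%N => [|i _]; last first.
    rewrite -sum1_card big_mkcond [RHS]big_mkcond; apply: eq_bigr => x _.
    by rewrite inE andbC; case: (x \in Z) => //=; case: (x \in U i).
  rewrite exchange_big -sum1_card; apply: leq_sum => x _ /=.
  have [/existsP[i xi]|/existsPn no] := boolP [exists i, x \in U i].
    rewrite (bigD1 i) //= xi big1 // => l li.
    by rewrite (disjointFr (dU i l _) xi) // eq_sym.
  by rewrite big1 // => i _; rewrite (negbTE (no i)).
have : (s * tau.+1 <= \sum_(i < s) (#|U i :&: X| + #|U i :&: Y|))%N.
  by rewrite -[s in (s * _)%N]card_ord -sum_nat_const; apply: leq_sum => i _.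
by rewrite big_split /= leqNgt (leq_ltn_trans _ small) // leq_add.
Qed.

End Weights.

Lemma card_split (T : finType) (S : {set T}) (P : nat -> nat -> bool) :
  #|[set A : {set T} | P #|A :&: S| #|A :\: S|]| =
  (\sum_(i < #|S|.+1) 'C(#|S|, i) * \sum_(j < #|~: S|.+1 | P i j) 'C(#|~: S|, j))%N.
Proof.
have draw (X : {set T}) (Q : pred nat) :
    #|[set A : {set T} | (A \subset X) && Q #|A|]| = (\sum_(j < #|X|.+1 | Q j) 'C(#|X|, j))%N.
  rewrite -sum1_card (partition_big (fun A : {set T} => inord #|A| : 'I_#|X|.+1) (fun j => Q j)) /=.
    apply: eq_bigr => j Qj; rewrite -[RHS]cards_draws -[RHS]sum1_card; apply: eq_bigl => A.
    rewrite !inE -andbA; case: (boolP (A \subset X)) => //= AX.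
    rewrite -val_eqE /= inordK ?ltnS ?subset_leq_card //.
    by case: eqP => [->|]; rewrite ?Qj ?andbF.
  move=> A; rewrite inE => /andP[AX QA].
  by rewrite inordK // ltnS subset_leq_card.
rewrite -sum1_card (partition_big (fun A : {set T} => inord #|A :&: S| : 'I_#|S|.+1) predT) //=.
apply: eq_bigr => i _; rewrite -(draw (~: S) (P i)).
have -> : 'C(#|S|, i) = #|[set A : {set T} | A \subset S & #|A| == i]| by rewrite cards_draws.
rewrite -cardsX -[RHS]sum1_card.
rewrite (reindex_onto (fun AB : {set T} * {set T} => AB.1 :|: AB.2)
   (fun A => (A :&: S, A :\: S))) /=; last by move=> A _; rewrite setID.
apply: eq_bigl => -[A B]; rewrite !inE /=.
apply/idP/idP.
  move=> /andP[/andP[PA /eqP iE] /eqP [A_E B_E]].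
  have AS : A \subset S by rewrite -A_E subsetIr.
  have BS : B \subset ~: S by rewrite -B_E setDE subsetIr.
  have cA : #|A| = i.
    by rewrite -A_E -iE inordK // ltnS subset_leq_card // subsetIr.
  by move: PA; rewrite A_E B_E AS BS cA eqxx.
move=> /andP[/andP[AS /eqP cA] /andP[BS PB]].
have A_E : (A :|: B) :&: S = A.
  rewrite setIUl (setIidPl AS) (_ : B :&: S = set0) ?setU0 //.
  by apply/eqP; rewrite setI_eq0 disjoints_subset.
have B_E : (A :|: B) :\: S = B.
  rewrite setDUl (_ : A :\: S = set0) ?set0U; last by apply/eqP; rewrite setD_eq0.
  by rewrite setDE; apply/setIidPl.
by rewrite A_E B_E cA PB /= eqxx andbT -val_eqE /= inordK.
Qed.

Lemma card_lt_level n (l : nat) :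
  #|[set A : {set 'I_n} | (#|A| < l.+1)%N]| = binom_le n l.
Proof.
have := card_split [set: 'I_n] (fun i _ => (i < l.+1)%N).
rewrite setCT cards0 cardsT card_ord => e.
transitivity #|[set A : {set 'I_n} | (#|A :&: [set: 'I_n]| < l.+1)%N]|.
  by apply: eq_card => A; rewrite !inE setIT.
rewrite e /binom_le.
transitivity (\sum_(0 <= i < n.+1 | (i < l.+1)%N) 'C(n, i))%N.
  rewrite big_mkord [RHS]big_mkcond; apply: eq_bigr => i _.
  by rewrite big_mkcond big_ord1 bin0; case: ifP; rewrite ?muln1 ?muln0.
rewrite -(big_mkord xpredT (fun i => 'C(n, i))).
have [ln|nl] := leqP l.+1 n.+1.
  rewrite (big_cat_nat (leq0n _) ln) /= [X in (_ + X)%N]big_nat_cond [X in (_ + X)%N]big1 ?addn0.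
    by rewrite big_nat_cond [RHS]big_nat; apply: eq_bigl => i; rewrite -andbA andbb.
  by move=> i /andP[/andP[li _]]; rewrite ltnNge li.
rewrite (big_cat_nat (leq0n _) (ltnW nl)) /= [X in _ = (_ + X)%N]big_nat [X in _ = (_ + X)%N]big1 ?addn0.
  rewrite big_nat_cond [RHS]big_nat; apply: eq_bigl => i.
  by case: (ltnP i n.+1) => //= i_n; rewrite (ltn_trans i_n).
by move=> i /andP[ni _]; rewrite bin_small.
Qed.

(** * Bounds on vex *)

Section VexBounds.
Variables (R : realFieldType) (n s t : nat).
Local Notation free := (graph_free (@complete_multipartite s t)).
Local Notation vexn := (vex n (@complete_multipartite s t)).

Lemma vex_attained : (0 < s)%N -> (0 < t)%N ->
  exists2 F : {set {set 'I_n}}, free F & #|F| = vexn.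
Proof.
move=> s0 t0.
have free0 : free (set0 : {set {set 'I_n}}).
  apply/graph_freeP => f _ fF _.
  by have := fF (Ordinal s0, Ordinal t0); rewrite inE.
have ne : (0 < #|[pred F : {set {set 'I_n}} | free F]|)%N.
  by apply/card_gt0P; exists set0.
have [F Ffree Fmax] := eq_bigmax_cond (fun F : {set {set 'I_n}} => #|F|) ne.
by exists F => //; rewrite /vex -Fmax.
Qed.

Lemma vex_missing (F : {set {set 'I_n}}) : free F ->
  2 ^+ n - vexn%:R <= #|~: F|%:R :> R.
Proof.
move=> freeF; have le : (#|F| <= vexn)%N 
  by exact: (@leq_bigmax_cond _ (fun F => free F) (fun F => #|F|) F freeF).
have := cardsC F; rewrite -[RHS]cardsT -powersetT card_powerset cardsT card_ord => e.
by rewrite lerBlDr -natrX -natrD ler_nat -e addnC leq_add2l.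
Qed.

Lemma vex_upper_levels (m : nat) : (2 <= m)%N -> (2 <= t)%N -> (n < s * m)%N ->
  2 ^+ n - vexn%:R <= (binom_le n (m - 2))%:R :> R.
Proof.
move=> m2 t2 nsm; apply: le_trans (vex_missing (weight_free
  (X := [set: 'I_n]) (Y := set0) (tau := m.-1) _ _)) _.
- by rewrite setCT cards0.
- by rewrite cardsT card_ord cards0 addn0 prednK // ltnW.
- rewrite -card_lt_level ler_nat; apply: subset_leq_card; apply/subsetP => A.
  by rewrite !inE setIT setI0 cards0 addn0 -ltnNge; congr (_ < _)%N; lia.
Qed.

(** The weight ignores one point [x], which leaves two possible sets per trace and hence needs
    [t >= 3]. Missing are the sets of size at most [m - 2] and those of size [m - 1] through [x]. *)
Lemma vex_upper_avoid (m : nat) : (2 <= m)%N -> (3 <= t)%N -> (0 < n)%N -> (n <= s * m)%N ->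
  2 ^+ n - vexn%:R <= 'C(n, m - 1)%:R - 'C(n - 1, m - 1)%:R + (binom_le n (m - 2))%:R :> R.
Proof.
move=> m2 t3 n0 nsm; pose x : 'I_n := Ordinal n0.
have cX : #|~: [set x]| = n.-1.
  by rewrite cardsC1 card_ord.
apply: le_trans (vex_missing (weight_free (X := ~: [set x]) (Y := set0) (tau := m.-1) _ _)) _.
- by rewrite setCK cards1.
- by rewrite cX cards0 addn0 (prednK (ltnW m2)) (leq_trans _ nsm) // (prednK n0).
have -> : 'C(n, m - 1)%:R - 'C(n - 1, m - 1)%:R = 'C(n.-1, m.-2)%:R :> R.
  have -> : (m - 1 = m.-2.+1)%N by lia.
  by rewrite subn1 -{1}(prednK n0) binS natrD addrAC subrr add0r.
rewrite -natrD ler_nat -card_lt_level addnC -cX -cards_draws.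
apply: (@leq_trans #|[set A : {set 'I_n} | (#|A| < (m - 2).+1)%N] :|:
  [set x |: B | B in [set B : {set 'I_n} | B \subset ~: [set x] & #|B| == m.-2]]|).
  apply: subset_leq_card; apply/subsetP => A.
  rewrite !inE setI0 cards0 addn0 -ltnNge => Am.
  have [xA|xA] := boolP (x \in A); last first.
    rewrite (setIidPl _) in Am; first by rewrite (_ : (m - 2).+1 = m.-1) ?Am //; lia.
    by rewrite subsetC sub1set inE.
  have AE : A :&: ~: [set x] = A :\ x by rewrite setDE.
  have cA : #|A| = #|A :\ x|.+1 by rewrite (cardsD1 x) xA.
  rewrite AE in Am; have [lt|ge] := leqP #|A| (m - 2); first by rewrite ltnS lt.
  apply/orP; right; apply/imsetP; exists (A :\ x); last by rewrite setD1K.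
  rewrite inE -{1}AE subsetIr /=; apply/eqP.
  by move: Am ge m2; rewrite cA; move: #|A :\ x| => c; clear; lia.
apply: leq_trans (leq_card_setU _ _).1 _.
by rewrite leq_add2l leq_imset_card.
Qed.

End VexBounds.

(** Substitute [l = m - 1 - i - j]. The window describes the sets of size below [m] whose weight
    reaches [m] when [i] of their points count twice. *)
Lemma sum_bin_window (N m i : nat) : (i + i <= m)%N -> (m <= N + i)%N ->
  (\sum_(j < N.+1 | (i + j < m <= i + i + j)%N) 'C(N, j) =
   \sum_(l < i) 'C(N, m - 1 - (i + l)))%N.
Proof.
move=> im mN.
rewrite -(big_mkord (fun j => (i + j < m <= i + i + j)%N) (fun j => 'C(N, j))).
have b1 : (m - (i + i) <= m - i)%N by lia.
have b2 : (m - i <= N.+1)%N by lia.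
rewrite (big_cat_nat (leq0n _) (leq_trans b1 b2)) (big_cat_nat b1 b2) /=.
rewrite [X in (X + _)%N]big_nat_cond [X in (X + _)%N]big1; last by move=> j; lia.
rewrite [X in (_ + (_ + X))%N]big_nat_cond [X in (_ + (_ + X))%N]big1; last by move=> j; lia.
rewrite add0n addn0 big_nat_cond.
rewrite (eq_bigl (fun j => (m - (i + i) <= j < m - i)%N)); last by move=> j; lia.
rewrite -big_nat big_nat_rev -{1}[(m - (i + i))%N]add0n big_addn.
have -> : (m - i - (m - (i + i)) = i)%N by lia.
rewrite big_mkord; apply: eq_bigr => l _; congr ('C(_, _)).
by have := ltn_ord l; lia.
Qed.

(** Points of a set [S] of size [s - 1] count twice, the largest size allowed with threshold [m]. Of
    the sets of size below [m], those of weight at least [m] are in the family; the double sum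
    counts them. *)
Lemma vex_upper_double (R : realFieldType) (k m : nat) :
  let n := (k.+3 * m)%N in (2 * k.+2 <= m)%N ->
  2 ^+ n - (vex n (@complete_multipartite k.+3 2))%:R <= (binom_le n (m - 1))%:R -
    (\sum_(i < k.+3) 'C(k.+2, i) * \sum_(l < i) 'C(n - k.+2, m - 1 - (i + l)))%N%:R :> R.
Proof.
move=> n km; have m0 : (0 < m)%N by lia.
have kn : (k.+2 <= n)%N by rewrite /n; nia.
have [|S _ cS] := @subset_of_card _ [set: 'I_n] k.+2; first by rewrite cardsT card_ord.
have cSC : #|~: S| = (n - k.+2)%N.
  by have := cardsC S; rewrite cS card_ord => /(congr1 (subn^~ k.+2)); rewrite addKn.
apply: le_trans (vex_missing R (weight_free (X := [set: 'I_n]) (Y := S) (tau := m) _ _)) _.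
- by rewrite setCT cards0.
- by rewrite cardsT card_ord cS /n mulnS addnC ltn_add2r.
rewrite lerBrDr -natrD ler_nat -card_lt_level.
have <- : #|[set A : {set 'I_n} | (#|A :&: S| + #|A :\: S| < m <= #|A :&: S| + #|A :&: S| + #|A :\: S|)%N]|
    = (\sum_(i < k.+3) 'C(k.+2, i) * \sum_(l < i) 'C(n - k.+2, m - 1 - (i + l)))%N.
  rewrite (card_split S (fun i j => (i + j < m <= i + i + j)%N)) cS cSC.
  apply: eq_bigr => i _; congr (_ * _)%N; apply: sum_bin_window; have := ltn_ord i.
    by lia.
  by rewrite /n; nia.
set W := [set A : {set 'I_n} | (#|A :&: S| + #|A :\: S| < m <= _)%N]; set Z := ~: _.
have dZW : [disjoint Z & W].
  rewrite -setI_eq0; apply/eqP/setP => A; rewrite !inE setIT; apply/negP.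
  have := cardsID S A; move: #|A| #|A :&: S| #|A :\: S| => a b d; lia.
rewrite -(card_disjointU dZW); apply: subset_leq_card; apply/subsetP => A.
rewrite !inE setIT; have := cardsID S A; move: #|A| #|A :&: S| #|A :\: S| => a b d; lia.
Qed.

Local Open Scope classical_set_scope.

(** * Limits of binomial ratios and the constant beta *)

Section Limits.
Variable R : realType.

Lemma cvg_natV : (fun m : nat => (m%:R : R)^-1) @ \oo --> (0 : R).
Proof. by rewrite -cvg_shiftS; exact: cvg_harmonic. Qed.

Lemma cvg_affine_ratio (p q r u : R) : r != 0 ->
  (fun m : nat => (p * m%:R + q) / (r * m%:R + u)) @ \oo --> p / r.
Proof.
move=> r0.
have aff (a b : R) : (fun m : nat => a + b * (m%:R)^-1) @ \oo --> a.
  by rewrite -[X in _ --> X]addr0 -[X in _ + X](mulr0 b);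
     apply: cvgD; [exact: cvg_cst|apply: cvgMr; exact: cvg_natV].
apply: cvg_trans (cvgM (aff p q) (cvgV r0 (aff r u))); apply: near_eq_cvg.
apply: filterS (nbhs_infty_ge 1%N) => m m1; have m0 : (m%:R : R) != 0.
  by rewrite pnatr_eq0 -lt0n.
rewrite /= /GRing.mul_fun /=.
have E (a b : R) : a + b / m%:R = (a * m%:R + b) / m%:R by field.
by rewrite !E invfM invrK mulrACA mulVf // mulr1.
Qed.

Lemma cvg_ord_sum N (f : 'I_N -> nat -> R) (l : 'I_N -> R) :
  (forall i, f i @ \oo --> l i) -> (fun m => \sum_i f i m) @ \oo --> \sum_i l i.
Proof.
elim: N f l => [|N IH] f l fl.
  rewrite big_ord0; under eq_fun do rewrite big_ord0; exact: cvg_cst.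
rewrite big_ord_recr; under eq_fun do rewrite big_ord_recr.
by apply: cvgD; [exact: IH|exact: fl].
Qed.

(** With [s = k.+3], deleting a point of the ground set multiplies the limit by [(s - 1) / s], and
    descending one level multiplies it by [1 / (s - 1)]. *)
Lemma cvg_bin_ratio (k c b : nat) :
  (fun m : nat => 'C(k.+3 * m - c, m - 1 - b)%:R / 'C(k.+3 * m, m - 1)%:R) @ \oo -->
  ((k.+2%:R / k.+3%:R) ^+ c * (k.+2%:R^-1) ^+ b : R).
Proof.
elim: c => [|c IHc].
  rewrite expr0 mul1r; elim: b => [|b IHb].
    rewrite expr0; apply: (@cvg_near_cst _ _ (1 : R)); apply: filterS (nbhs_infty_ge 0%N) => m _.
    rewrite !subn0 divff // pnatr_eq0 -lt0n bin_gt0.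
    by rewrite mulSn; apply: leq_trans (leq_addr _ _); rewrite leq_subr.
  have k2 : (k.+2%:R : R) != 0 by rewrite pnatr_eq0.
  have hlim := @cvgM _ _ _ (@eventually_filter) _ _ _ _ IHb (@cvg_affine_ratio 1 (- b.+1%:R) k.+2%:R b.+2%:R k2).
  rewrite div1r -exprSr in hlim; apply: cvg_trans hlim; apply: near_eq_cvg.
  apply: filterS (nbhs_infty_ge (b + 2)) => m /= bm.
  rewrite /= /GRing.mul_fun /= !subn0.
  have := mul_bin_left (k.+3 * m) (m - 1 - b.+1).
  have -> : ((m - 1 - b.+1).+1 = m - 1 - b)%N by lia.
  have -> : (k.+3 * m - (m - 1 - b.+1) = k.+2 * m + b.+2)%N by rewrite mulSn; lia.
  move=> /(congr1 (fun x => x%:R : R)); rewrite !natrM => E.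
  have -> : 1 * m%:R - b.+1%:R = (m - 1 - b)%:R :> R.
    by rewrite mul1r -natrB; [congr (_%:R); lia|lia].
  have -> : k.+2%:R * m%:R + b.+2%:R = (k.+2 * m + b.+2)%:R :> R by rewrite natrD natrM.
  have d0 : ((k.+2 * m + b.+2)%:R : R) != 0 by rewrite pnatr_eq0 addnS.
  rewrite mulrAC mulrA; congr (_ / _).
  by apply: (mulIf d0); rewrite divfK // mulrC E mulrC.
have k3 : (k.+3%:R : R) != 0 by rewrite pnatr_eq0.
have hlim := @cvgM _ _ _ (@eventually_filter) _ _ _ _ IHc (@cvg_affine_ratio k.+2%:R (1 + b%:R - c%:R) k.+3%:R (- c%:R) k3).
rewrite exprSr mulrAC; apply: cvg_trans hlim; apply: near_eq_cvg.
apply: filterS (nbhs_infty_ge (b + c + 2)) => m /= bm.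
rewrite /= /GRing.mul_fun /=.
have := mul_bin_down (k.+3 * m - c) (m - 1 - b).
have -> : ((k.+3 * m - c).-1 = k.+3 * m - c.+1)%N by lia.
have c1 : (c <= k.+3 * m)%N by nia.
have c2 : (m - 1 - b <= k.+3 * m - c)%N by nia.
move=> /(congr1 (fun x => x%:R : R)); rewrite !natrM (natrB _ c2) (natrB _ c1).
have -> : (m - 1 - b)%:R = m%:R - 1 - b%:R :> R by rewrite !natrB //; lia.
rewrite natrM => E.
have d0 : k.+3%:R * m%:R - c%:R != 0 :> R.
  by rewrite -natrM -natrB // pnatr_eq0; nia.
rewrite mulrAC mulrA; congr (_ / _); apply: (mulIf d0); rewrite divfK // mulrC.
rewrite [RHS]mulrC E; congr (_ * _).
by rewrite -[k.+3%:R]natr1; ring.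
Qed.

Lemma beta_algebra (c : R) : 2 <= c ->
  [/\ c / (c + 1) * (1 + c^-1) = 1,
      c / (c + 1) * (1 + c^-1 ^+ 2) = 1 - (c + 1 - 2) / ((c + 1) ^+ 2 - (c + 1)) &
      (1 - c^-1)^-1 = (c + 1 - 1) / (c + 1 - 2)].
Proof.
move=> c2; have c0 : c != 0 by apply/eqP => e; lra.
have c1 : c + 1 != 0 by apply/eqP => e; lra.
have c1' : c - 1 != 0 by apply/eqP => e; lra.
split; first by field; rewrite c0 c1.
  have -> : (c + 1) ^+ 2 - (c + 1) = (c + 1) * c by ring.
  by field; rewrite c0 c1.
have -> : c + 1 - 2 = c - 1 by ring.
by field; rewrite c0 c1'.
Qed.

(** Sum the inner geometric series with ratio [x = 1 / (s - 1)], then apply the binomial theorem at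
    [x] and at [x ^+ 2]. *)
Lemma sum_beta (k : nat) :
  \sum_(i < k.+3) 'C(k.+2, i)%:R *
    \sum_(l < i) ((k.+2%:R / k.+3%:R) ^+ k.+2 * (k.+2%:R^-1) ^+ (i + l)) = beta R k.+3.
Proof.
set s : R := k.+3%:R; set c : R := k.+2%:R; set x := c^-1.
have c2 : 2 <= c by rewrite /c ler_nat.
have c0 : c != 0 by rewrite /c pnatr_eq0.
have sE : s = c + 1 by rewrite /s /c natr1.
have s0 : s != 0 by rewrite /s pnatr_eq0.
have x1 : 1 - x != 0.
  rewrite subr_eq0; apply/eqP => e; have : c * x = 1 by rewrite divff.
  by rewrite -e; lra.
have geo i : \sum_(l < i) x ^+ l = (1 - x ^+ i) / (1 - x).
  apply: (mulIf x1); rewrite divfK //.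
  by rewrite -[RHS]opprB subrX1 -mulNr opprB mulrC.
rewrite (eq_bigr (fun i : 'I_k.+3 => (c / s) ^+ k.+2 / (1 - x) *
   ((x ^+ i) *+ 'C(k.+2, i) - ((x ^+ 2) ^+ i) *+ 'C(k.+2, i)))); last first.
  move=> i _; rewrite (eq_bigr (fun l : 'I_i => (c / s) ^+ k.+2 * x ^+ i * x ^+ l)).
    rewrite -mulr_sumr geo -exprM mul2n -addnn exprD.
    rewrite -[x ^+ i *+ _]mulr_natr -[x ^+ i * x ^+ i *+ _]mulr_natr.
    move: (x ^+ i) (_ ^+ k.+2) ((1 - x)^-1) ('C(_, _)%:R) => y a z N; ring.
  by move=> l _; rewrite exprD mulrA.
rewrite -mulr_sumr sumrB.
have bino (y : R) : \sum_(i < k.+3) (y ^+ i) *+ 'C(k.+2, i) = (1 + y) ^+ k.+2.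
  by rewrite exprDn; apply: eq_bigr => i _; rewrite expr1n mul1r.
rewrite !bino mulrBr mulrAC [X in _ - X]mulrAC -!exprMn /beta subn1 /= -/s.
have [e1 e2 e3] := beta_algebra c2; rewrite -/x -sE in e1 e2 e3.
by rewrite e1 e2 expr1n -mulrBl mulrC e3.
Qed.

End Limits.

(** * Asymptotic form of the bounds *)

Section Assembly.
Variable R : realType.

Lemma relative_error (d T : nat -> R) (C : R) (N : nat) :
  (forall m, (N <= m)%N -> 0 < T m /\ (1 - C * m%:R^-1) * T m <= d m <= T m) ->
  exists2 e : nat -> R, e @ \oo --> (0 : R) &
    \forall m \near \oo, d m = (1 + e m) * T m.
Proof.
move=> dT; exists (fun m => d m / T m - 1); last first.
  apply: filterS (nbhs_infty_ge N) => m /= /dT [T0 _].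
  by rewrite subrKC divfK // gt_eqF.
have lim : (fun m : nat => - C * m%:R^-1) @ \oo --> (0 : R).
  by rewrite -[X in _ --> X](mulr0 (- C)); apply: cvgMr; exact: cvg_natV.
apply: (squeeze_cvgr _ lim (cvg_cst (0 : R))).
apply: filterS (nbhs_infty_ge N) => m /= /dT [T0 /andP[lo up]].
by rewrite lerBrDl subr_le0 mulNr ler_pdivlMr // ler_pdivrMr // mul1r lo up.
Qed.

(** This is [missing_lower] for an extremal family, with [m./2] replaced by the smaller [m / 3]. *)
Lemma vex_lower (k t m n : nat) (delta : R) :
  (k.+3 * m <= n.+1)%N -> (n <= k.+3 * m)%N -> (10 * t.+1 <= m)%N -> (2 <= t)%N ->
  0 <= delta ->
  (forall F : {set {set 'I_n}}, graph_free (@complete_multipartite k.+3 t) F ->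
     n.+1%:R / k.+3%:R - m%:R + delta <= level_density R (fun A => A \notin F) m.-1 \/
     delta <= level_density R (fun A => A \notin F) m) ->
  (1 - 3 * t.+1%:R * m%:R^-1) * ((binom_le n (m - 2))%:R +
      'C(n, m - 1)%:R * (n.+1%:R / k.+3%:R - m%:R + delta / 2)) <=
    2 ^+ n - (vex n (@complete_multipartite k.+3 t))%:R :> R.
Proof.
move=> n_lo n_hi mt t2 delta0 gap.
have [F free <-] := @vex_attained n k.+3 t isT (ltnW t2).
have m5 : (5 <= m)%N by lia.
have mt2 : (2 * t <= m)%N by lia.
have mhalf : (m <= 3 * m./2)%N by lia.
apply: le_trans (missing_lower n_lo n_hi m5 mt2 t2 free delta0 (gap F free)).
rewrite subn1; apply: ler_wpM2r.
  rewrite addr_ge0 // mulr_ge0 // addr_ge0 ?divr_ge0 //.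
  by rewrite subr_ge0 ler_pdivlMr ?ltr0n // -natrM ler_nat mulnC.
have h0 : 0 < m./2%:R :> R by rewrite ltr0n; lia.
have m0 : 0 < m%:R :> R by rewrite ltr0n; lia.
rewrite lerD2l lerN2 ler_pdivrMr // mulrAC ler_pdivlMr //.
by rewrite -!natrM ler_nat mulnAC mulnC leq_mul2r mhalf orbT.
Qed.

Lemma succ_div_sub k m : (k.+1 * m).+1%:R / k.+1%:R - m%:R = k.+1%:R^-1 :> R.
Proof.
have k0 : k.+1%:R != 0 :> R by rewrite pnatr_eq0.
by rewrite -natr1 natrM mulrDl mul1r [k.+1%:R * _]mulrC mulfK // addrC addKr.
Qed.

Lemma regroup (B c s x y : R) : s != 0 ->
  B + c - ((s - 1) / s - x + y) * c = B + c * (s^-1 + x) - y * c.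
Proof. by move=> s0; field. Qed.

Lemma binom_le_gt0 n l : 0 < (binom_le n l)%:R :> R.
Proof. by rewrite ltr0n /binom_le big_ord_recl bin0. Qed.

Lemma beta_gt0 k : 0 < beta R k.+3.
Proof.
rewrite -sum_beta (bigD1 (Ordinal (isT : 1 < k.+3)%N)) //=.
apply: ltr_wpDr.
  apply: sumr_ge0 => i _; apply: mulr_ge0 => //; apply: sumr_ge0 => l _.
  by rewrite mulr_ge0 // exprn_ge0 // ?divr_ge0 // invr_ge0.
have k2 : 0 < k.+2%:R :> R by rewrite ltr0n.
rewrite big_ord1 bin1; exact: mulr_gt0.
Qed.

Lemma cvg_double_levels (k : nat) :
  (fun m : nat => (\sum_(i < k.+3) 'C(k.+2, i) *
      \sum_(l < i) 'C(k.+3 * m - k.+2, m - 1 - (i + l)))%N%:R /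
    'C(k.+3 * m, m - 1)%:R) @ \oo --> beta R k.+3.
Proof.
rewrite -sum_beta.
have -> : (fun m : nat => (\sum_(i < k.+3) 'C(k.+2, i) *
      \sum_(l < i) 'C(k.+3 * m - k.+2, m - 1 - (i + l)))%N%:R / 'C(k.+3 * m, m - 1)%:R)
  = (fun m : nat => \sum_(i < k.+3) 'C(k.+2, i)%:R * \sum_(l < i)
      ('C(k.+3 * m - k.+2, m - 1 - (i + l))%:R / 'C(k.+3 * m, m - 1)%:R)) :> (nat -> R).
  apply/funext => m; rewrite natr_sum mulr_suml; apply: eq_bigr => i _.
  by rewrite natrM natr_sum -mulrA mulr_suml.
apply: cvg_ord_sum => i; apply: cvgMr; apply: cvg_ord_sum => l.
exact: cvg_bin_ratio.
Qed.

End Assembly.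

Theorem theorem1p2 (R : realType) (s : nat) (hs : (3 <= s)%N) :
  (forall t : nat, (2 <= t)%N ->
     exists2 e : nat -> R, e @ \oo --> (0 : R) &
       \forall m \near \oo,
         let n := (s * m - 1)%N in
         2 ^+ n - (vex n (@complete_multipartite s t))%:R
           = (1 + e m) * (binom_le n (m - 2))%:R)
  /\
  (forall t : nat, (3 <= t)%N ->
     exists2 e : nat -> R, e @ \oo --> (0 : R) &
       \forall m \near \oo,
         let n := (s * m)%N in
         2 ^+ n - (vex n (@complete_multipartite s t))%:R
           = (1 + e m) * (('C(n, m - 1))%:R - ('C(n - 1, m - 1))%:R
                          + (binom_le n (m - 2))%:R))
  /\
  (exists2 delta : R, 0 < delta &
     exists e1 e2 : nat -> R,
       [/\ e1 @ \oo --> (0 : R), e2 @ \oo --> (0 : R) &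
         \forall m \near \oo,
           let n := (s * m)%N in
           let d : R := 2 ^+ n - (vex n (@complete_multipartite s 2))%:R in
           (binom_le n (m - 1))%:R
             - (1 + e1 m) * beta R s * ('C(n, m - 1))%:R >= d
           /\
           d >= (binom_le n (m - 1))%:R
             - ((s%:R - 1) / s%:R - delta + e2 m) * ('C(n, m - 1))%:R]).
Proof.
case: s hs => [|[|[|k]]] // _; split; [|split].
- move=> t t2; apply: (@relative_error R _ _ (3 * t.+1%:R) (10 * t.+1)) => m mt.
  set n := (k.+3 * m - 1)%N; have nE : n.+1 = (k.+3 * m)%N by rewrite /n; nia.
  split; first exact: binom_le_gt0.
  apply/andP; split; last by apply: vex_upper_levels => //; [lia|rewrite -nE].
  have rho : n.+1%:R / k.+3%:R - m%:R = 0 :> R.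
    by rewrite nE natrM mulrAC divff ?mul1r ?subrr // pnatr_eq0.
  have n_lo : (k.+3 * m <= n.+1)%N by rewrite nE.
  have n_hi : (n <= k.+3 * m)%N by rewrite -nE leqnSn.
  (* With [delta = 0] the gap is free, because densities are nonnegative. *)
  have := vex_lower n_lo n_hi mt t2 (lexx 0)
    (fun F _ => or_intror (level_density_ge0 R _ _)).
  by rewrite rho mul0r addr0 mulr0 addr0.
- move=> t t3; apply: (@relative_error R _ _ (3 * t.+1%:R) (10 * t.+1)) => m mt.
  set n := (k.+3 * m)%N; have n0 : (0 < n)%N by rewrite /n; nia.
  have m2 : (2 <= m)%N by lia.
  have CE : 'C(n, m - 1)%:R - 'C(n - 1, m - 1)%:R = 'C(n.-1, m.-2)%:R :> R.
    have -> : (m - 1 = m.-2.+1)%N by lia.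
    by rewrite subn1 -{1}(prednK n0) binS natrD addrAC subrr add0r.
  split; first by rewrite CE ltr_wpDl // binom_le_gt0.
  apply/andP; split; last exact: vex_upper_avoid.
  have rho : n.+1%:R / k.+3%:R - m%:R = k.+3%:R^-1 :> R.
    exact: succ_div_sub.
  have n_lo : (k.+3 * m <= n.+1)%N := leqnSn n.
  have n_hi : (n <= k.+3 * m)%N := leqnn n.
  have := @vex_lower R k t m n 0 n_lo n_hi mt (ltnW t3) (lexx 0)
    (fun F _ => or_intror (level_density_ge0 R _ _)).
  rewrite rho mul0r addr0; apply: le_trans; apply: ler_wpM2l.
    rewrite subr_ge0 ler_pdivrMr ?ltr0n; last by lia.
    by rewrite mul1r -natrM ler_nat; lia.
  (* What remains is ['C(n - 1, m - 2) <= 'C(n, m - 1) / s]; the ratio of these coefficients is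
     [(m - 1) / n]. *)
  rewrite CE addrC lerD2l ler_pdivlMr ?ltr0n //.
  have mE : (m - 1 = m.-2.+1)%N by lia.
  have m0 : 0 < m%:R :> R by rewrite ltr0n; lia.
  rewrite -(ler_pM2l m0) -!natrM ler_nat mulnCA [X in (_ * X)%N]mulnC mulnC -/n.
  by rewrite mul_bin_diag -mE leq_mul2r leq_subr orbT.
pose eps : R := (27%:R * k.+2%:R)^-1.
pose dl : R := eps ^+ 2 / (90%:R * 80%:R * k.+3%:R ^+ 2).
have eps0 : 0 < eps by rewrite invr_gt0 mulr_gt0 ?ltr0n.
have dl0 : 0 < dl by rewrite divr_gt0 ?exprn_gt0 ?mulr_gt0 ?ltr0n.
have k3 : 3 <= k.+3%:R :> R by rewrite ler_nat.
have k30 : k.+3%:R != 0 :> R by rewrite pnatr_eq0.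
have dl1 : dl <= 1.
  have eps1 : eps <= 1.
    by rewrite invf_le1 ?mulr_gt0 ?ltr0n // -natrM -[1]/(1%:R) ler_nat; lia.
  rewrite /dl ler_pdivrMr ?mulr_gt0 ?exprn_gt0 ?ltr0n // mul1r.
  have : eps ^+ 2 <= 1 by rewrite expr_le1 // ltW.
  by rewrite !expr2; nra.
pose D m : R := (\sum_(i < k.+3) 'C(k.+2, i) *
  \sum_(l < i) 'C(k.+3 * m - k.+2, m - 1 - (i + l)))%N%:R.
have b0 := beta_gt0 R k.
exists (dl / 2); first by rewrite divr_gt0.
(* This error makes the upper bound exactly [D m]; the next one is the loss [9 / m] times the bound
   [3 * c] on the main term. *)
exists (fun m => D m / 'C(k.+3 * m, m - 1)%:R / beta R k.+3 - 1).
exists (fun m => 27%:R * m%:R^-1); split.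
- rewrite -[X in _ --> X](subrr 1) -[X in _ --> X - _](divff (lt0r_neq0 b0)).
  by apply: cvgB; [apply: cvgMl; exact: cvg_double_levels|exact: cvg_cst].
- by rewrite -[X in _ --> X](mulr0 27%:R); apply: cvgMr; exact: cvg_natV.
apply: filterS (nbhs_infty_ge (30 + 2 * k.+2)) => m /= mk.
have m30 : (10 * 3 <= m)%N by move: mk; clear; lia.
set n := (k.+3 * m)%N; set c : R := 'C(n, m - 1)%:R.
have [m_gt0 m2] : (0 < m)%N /\ (2 <= m)%N by move: mk; clear; lia.
have m12 : (m - 1 = (m - 2).+1)%N by move: mk; clear; lia.
have mn : (m - 1 <= n)%N by rewrite /n; move: m_gt0; clear; nia.
have c0 : 0 < c by rewrite ltr0n bin_gt0.
have m0 : 0 < m%:R :> R by rewrite ltr0n.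
split.
  have -> : (1 + (D m / c / beta R k.+3 - 1)) * beta R k.+3 * c = D m.
    by rewrite subrKC divfK ?lt0r_neq0 // divfK ?lt0r_neq0.
  by apply: vex_upper_double; lia.
have BE : (binom_le n (m - 1))%:R = (binom_le n (m - 2))%:R + c :> R.
  rewrite /c -natrD /binom_le; congr (_%:R).
  by rewrite m12 big_ord_recr.
have Bc : (binom_le n (m - 2))%:R <= c.
  rewrite ler_nat /binom_le -(big_mkord xpredT (fun i => 'C(n, i))).
  by rewrite -m12; apply: sum_bin_le; rewrite /n; nia.
have rho : n.+1%:R / k.+3%:R - m%:R = k.+3%:R^-1 :> R.
  exact: succ_div_sub.
have gap (F : {set {set 'I_n}}) : graph_free (@complete_multipartite k.+3 2) F ->
     n.+1%:R / k.+3%:R - m%:R + dl <= level_density R (fun A => A \notin F) m.-1 \/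
     dl <= level_density R (fun A => A \notin F) m.
  move=> free; rewrite rho.
  have [h1|h1] := leP (k.+3%:R^-1 + dl) (level_density R (fun A => A \notin F) m.-1); first by left.
  have [h2|h2] := leP dl (level_density R (fun A => A \notin F) m); first by right.
  exfalso; apply: (@level_gap_small R n m k (fun A => A \notin F) eps) => //.
  by move=> P; exact: block_missing.
have n_lo : (k.+3 * m <= n.+1)%N := leqnSn n.
have n_hi : (n <= k.+3 * m)%N := leqnn n.
have := @vex_lower R k 2 m n dl n_lo n_hi m30 isT (ltW dl0) gap.
rewrite rho => low; apply: le_trans low.
have -> : (binom_le n (m - 1))%:R - ((k.+3%:R - 1) / k.+3%:R - dl / 2 + 27%:R / m%:R) * c =
    (binom_le n (m - 2))%:R + c * (k.+3%:R^-1 + dl / 2) - 27%:R / m%:R * c :> R.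
  by rewrite BE; exact: regroup.
rewrite -/c mulrBl mul1r lerD2l lerN2.
have inv3 : k.+3%:R^-1 <= 1 :> R by rewrite invf_le1 ?ltr0n // ler1n.
have mV : 0 <= m%:R^-1 :> R by rewrite invr_ge0 ltW.
have -> : 27%:R / m%:R * c = 3 * 3 * m%:R^-1 * (3 * c) :> R by ring.
apply: ler_wpM2l; first by rewrite mulr_ge0 // mulr_ge0.
have dl2 : dl / 2 <= 1.
  by rewrite ler_pdivrMr // mul1r (le_trans dl1) // ler1n.
have -> : 3 * c = c + c * (1 + 1) :> R by ring.
by apply: lerD => //; rewrite ler_pM2l //; exact: lerD.
Qed.
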